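(* Let $n\ge 1$, let $1\le d\le n$, and let $\lambda$ be the $n$-partition $(d,\dots,d,d-1,\dots,2,1)$, i.e. $\lambda_i=\min(d,n+1-i)$ for $1\le i\le n$. Let $w\in S_n$. If $w$ is 312-avoiding, then $$\mathcal{D}_\lambda(w)=\{T\in\mathcal{T}_\lambda \mid T\le Y_\lambda(w)\}.$$
   Context: An $n$-partition is $\lambda=(\lambda_1\ge\cdots\ge\lambda_n\ge0)$; its Young diagram has $\lambda_i$ left-justified boxes in row $i$, and $(j,i)$ denotes the box in column $j$ and row $i$. $\zeta=(\zeta_1,\dots,\zeta_{\lambda_1})$ is the sequence of column lengths. $\mathcal{T}_\lambda$ is the set of semistandard tableaux of shape $\lambda$: fillings with entries in $\{1,\dots,n\}$, weakly increasing along rows and strictly increasing down columns. $T\le T'$ means entry-wise comparison: $T(j,i)\le T'(j,i)$ for all boxes $(j,i)$. The one rowed form of $w\in S_n$ is $(x_1,\dots,x_n)$ with $x_i=w(i)$. $w$ is 312-avoiding if there do not exist $1\le a<b<c\le n$ with $x_b<x_c<x_a$. The key of $w$, $Y_\lambda(w)$, is the tableau of shape $\lambda$ each of whose columns of length $k$ consists of $x_1,\dots,x_k$ arranged in increasing order downward. A skew tableau is a filling of a skew diagram with entries in $\{1,\dots,n\}$, weakly increasing along rows and strictly increasing down columns. Its rectification is the (well-defined) semistandard tableau obtained by successive jeu de taquin slides into inside corners until none are left. It is frank if its column lengths are a rearrangement of those of its rectification. For $T\in\mathcal{T}_\lambda$, the right key $R(T)$ is the tableau of shape $\lambda$ whose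 $j$th column is the rightmost column of any frank skew tableau that rectifies to $T$ and whose rightmost column has length $\zeta_j$ (this is well defined). The set of Demazure tableaux for $\lambda$ and $w$ is $\mathcal{D}_\lambda(w):=\{T\in\mathcal{T}_\lambda\mid R(T)\le Y_\lambda(w)\}$. *)

(* Defs.v *)
From mathcomp Require Import all_boot all_fingroup.
From mathcomp Require Import classical_sets.
Set Implicit Arguments.
Unset Strict Implicit.
Unset Printing Implicit Defensive.
Local Open Scope classical_set_scope.

(* Conventions.  Everything is numbered from 0: the entries {1, ..., n} are the
   elements of 'I_n, and a box is a pair (column, row), rows going downward.
   Partitions are sequences of row lengths, read with default value 0, so that
   trailing zeros are harmless. *)

Definition box := (nat * nat)%type.

(* A filling is a partial map: its domain is the diagram, so that equality of
   fillings is equality of diagrams and of all entries. *)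
Definition filling (n : nat) := box -> option 'I_n.

Definition is_partition (la : seq nat) : bool := sorted geq la.

Definition in_diagram (la : seq nat) (b : box) : bool := b.1 < nth 0 la b.2.

Definition has_shape n (mu la : seq nat) (T : filling n) : Prop :=
  [/\ is_partition mu, is_partition la,
      forall i, nth 0 mu i <= nth 0 la i
    & forall b, isSome (T b) = in_diagram la b && ~~ in_diagram mu b].

(* T is a skew tableau of shape la / mu.  The pair (mu, la) is part of the data,
   as the inside corners depend on mu and not only on the set of boxes. *)
Definition skew_tableau n (mu la : seq nat) (T : filling n) : Prop :=
  [/\ has_shape mu la T,
      forall (j j' i : nat) (x y : 'I_n),
        j < j' -> T (j, i) = Some x -> T (j', i) = Some y -> x <= y
    & forall (j i i' : nat) (x y : 'I_n),
        i < i' -> T (j, i) = Some x -> T (j, i') = Some y -> x < y].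

Definition ssyt n (la : seq nat) (T : filling n) : Prop :=
  skew_tableau [::] la T.

Definition filling_le n (T T' : filling n) : Prop :=
  forall b (x y : 'I_n), T b = Some x -> T' b = Some y -> x <= y.

(* The nonempty columns, from left to right, each one read downward.  A skew
   diagram may have empty columns; these are disregarded. *)
Definition columns n (la : seq nat) (T : filling n) : seq (seq 'I_n) :=
  [seq c <- [seq pmap (fun i => T (j, i)) (iota 0 (size la))
            | j <- iota 0 (head 0 la)] | c != [::]].

Definition column_lengths n (la : seq nat) (T : filling n) : seq nat :=
  [seq size c | c <- columns la T].

Definition conjugate_part (la : seq nat) (j : nat) : nat :=
  count (fun r => j < r) la.

Definition right_of (b : box) : box := (b.1.+1, b.2).
Definition below (b : box) : box := (b.1, b.2.+1).

Definition move_entry n (T : filling n) (src dst : box) : filling n :=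
  fun b => if b == dst then T src else if b == src then None else T b.

(* slide T b T': a hole at b moves to the outer boundary of T, giving T'.  At
   each step the smaller of the entries to the right and below enters the hole;
   when they are equal it is the one below. *)
Inductive slide n (T : filling n) (b : box) : filling n -> Prop :=
| slide_stop of T (right_of b) = None & T (below b) = None : slide T b T
| slide_right (x : 'I_n) T' of
    T (right_of b) = Some x
  & (forall y : 'I_n, T (below b) = Some y -> x < y)
  & slide (move_entry T (right_of b) b) (right_of b) T' : slide T b T'
| slide_below (y : 'I_n) T' of
    T (below b) = Some y
  & (forall x : 'I_n, T (right_of b) = Some x -> y <= x)
  & slide (move_entry T (below b) b) (below b) T' : slide T b T'.

Definition inside_corner (mu : seq nat) (b : box) : bool :=
  [&& in_diagram mu b, ~~ in_diagram mu (right_of b)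
    & ~~ in_diagram mu (below b)].

Definition remove_corner (mu : seq nat) (b : box) : seq nat :=
  set_nth 0 mu b.2 b.1.

Inductive rectifies n (mu : seq nat) (S : filling n) : filling n -> Prop :=
| rectifies_done of (forall b, ~~ inside_corner mu b) : rectifies mu S S
| rectifies_slide b S' T of
    inside_corner mu b & slide S b S' & rectifies (remove_corner mu b) S' T :
    rectifies mu S T.

(* S is a frank skew tableau of shape nu / mu whose rectification is the
   tableau T of shape la. *)
Definition frank_rectifies_to n (mu nu : seq nat) (S : filling n)
    (la : seq nat) (T : filling n) : Prop :=
  [/\ skew_tableau mu nu S, rectifies mu S T
    & perm_eq (column_lengths nu S) (column_lengths la T)].

(* R is the right key of T.  The rightmost column depends only on T and on the
   prescribed length, so R is the unique filling with this property. *)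
Definition is_right_key n (la : seq nat) (T R : filling n) : Prop :=
  has_shape [::] la R /\
  forall j, j < head 0 la ->
    exists mu nu (S : filling n),
      [/\ frank_rectifies_to mu nu S la T,
          size (last [::] (columns nu S)) = conjugate_part la j
        & nth [::] (columns la R) j = last [::] (columns nu S)].

Definition one_rowed n (w : 'S_n) : seq 'I_n := [seq w i | i <- enum 'I_n].

Definition avoids_312 n (w : 'S_n) : Prop :=
  ~ exists a b c : 'I_n, [/\ a < b, b < c, w b < w c & w c < w a].

(* For a partition la with at most n rows, the i-th entry of column j exists
   exactly when i < conjugate_part la j, so this filling has shape la. *)
Definition key n (la : seq nat) (w : 'S_n) : filling n :=
  fun b => onth (sort (fun x y : 'I_n => x <= y)
                   (take (conjugate_part la b.1) (one_rowed w))) b.2.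

Definition demazure n (la : seq nat) (w : 'S_n) : set (filling n) :=
  [set T | ssyt la T /\
     exists R : filling n, is_right_key la T R /\ filling_le R (key la w)].

(* (d, ..., d, d - 1, ..., 2, 1) with n parts; row i (from 0) is the
   (i + 1)-st part min (d, n + 1 - (i + 1)). *)
Definition staircase_part (n d : nat) : seq nat :=
  mkseq (fun i => minn d (n - i)) n.

(* Main.v *)
Require Import Defs.
From mathcomp Require Import all_boot all_fingroup.
From mathcomp Require Import classical_sets boolp zify.
Set Implicit Arguments.
Unset Strict Implicit.
Unset Printing Implicit Defensive.

(** A skew tableau is replaced by its 0/1 matrix: the entry in row v and
    column c says whether the value v occurs in column c of the tableau. Fix
    two adjacent columns i and i + 1 and match values of column i + 1, as
    closing brackets, with smaller or equal values of column i, as opening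
    brackets. During a jeu de taquin slide the matrix changes only when the
    hole moves to the right, and the entry that then crosses from column i +
    1 to column i is the largest unmatched value of column i + 1
    ([hole_right]). So a rectification is a sequence of crystal raising
    operators on the columns ([rectifies_raises]), and a matrix is that of a
    straight tableau exactly when no such operator applies to it.

    The end of a sequence of raisings depends only on its start
    ([straight_unique]). The matrix carries a second crystal structure, on
    the values, and the two commute ([raisable_commute]); raising the values
    as far as possible reduces uniqueness to matrices extremal for both
    structures, which are determined by how often each value occurs.
    Everything about rectification that is needed follows from this
    uniqueness.

    The column lengths of any skew tableau are majorized by those of its
    rectification ([excess_raises]), and for a frank tableau they agree, so
    there is no room for raisings that spread the lengths further: of two
    adjacent columns the shorter is completely matched ([frank_pair]). Push
    the last column of a frank tableau to the left past the shorter columns,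
    exchanging lengths each time. Every exchange makes it smaller entry by
    entry, and at the end it is a column of the rectification T
    ([frank_last_column]). So T <= R(T), and R(T) <= Y gives T <= Y
    ([right_key_le]).

    Conversely let T <= Y with w 312-avoiding. To compute column j of the
    right key, move the j-th column of T to the right end by inverse
    raisings. It has to stay below the column P of Y that consists of the
    first n - j letters of w. The inequalities [fits] say what is needed of
    a column and its right neighbour. They survive each single move
    ([lower_many]), and 312-avoidance supplies them whenever a new
    neighbour, bounded by a shorter prefix Q of w, is met ([fits_prefix]):
    if a value v is missing from P, then either all of Q lies below v or Q
    contains every element of P below v. The resulting matrix is realized by
    a skew tableau ([place_skew]), which is frank, and by uniqueness it
    rectifies to T ([frank_witness]). *)

(** * Counting functions and 0/1 matrices *)

Definition cnt (p : nat -> bool) (y : nat) : nat := \sum_(v < y) (p v : nat).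

Lemma cnt0 p : cnt p 0 = 0. Proof. by rewrite /cnt big_ord0. Qed.
Lemma cntS p y : cnt p y.+1 = cnt p y + p y.
Proof. by rewrite /cnt big_ord_recr. Qed.
Lemma cnt_mono p y z : y <= z -> cnt p y <= cnt p z.
Proof.
move=> h; rewrite -(subnKC h); elim: (z - y) => [|k IH]; first by rewrite addn0.
by rewrite addnS cntS; lia.
Qed.

Lemma cnt_le p y z : y <= z -> cnt p z <= cnt p y + (z - y).
Proof.
move=> h; rewrite -{1}(subnKC h); elim: (z - y) => [|k IH]; first by rewrite !addn0.
by rewrite addnS cntS; case: (p _); lia.
Qed.

Lemma eq_cnt (p q : nat -> bool) y : (forall v, v < y -> p v = q v) -> cnt p y = cnt q y.
Proof. by move=> h; apply: eq_bigr => i _; rewrite h. Qed.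
Lemma cnt_stable (p : nat -> bool) n y :
  (forall v, p v -> v < n) -> n <= y -> cnt p y = cnt p n.
Proof.
move=> h hy; rewrite -(subnKC hy); elim: (y - n) => [|k IH]; rewrite ?addn0 // addnS cntS IH.
case E: (p _); last by rewrite addn0.
by have := h _ E; lia.
Qed.

(** The first argument is a value, the second a column. *)
Definition mat := nat -> nat -> bool.
Definition colcnt (M : mat) c y := cnt (fun v => M v c) y.
Definition rowcnt (M : mat) v q := cnt (M v) q.
Definition tr (M : mat) : mat := fun c v => M v c.
Definition pull (M : mat) i x : mat := fun v c =>
  (M v c && ~~ ((v == x) && (c == i.+1))) || ((v == x) && (c == i)).

Lemma pullE M i x v c : pull M i x v c =
  (M v c && ~~ ((v == x) && (c == i.+1))) || ((v == x) && (c == i)).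
Proof. by []. Qed.
Lemma colcntS M c y : colcnt M c y.+1 = colcnt M c y + M y c. Proof. exact: cntS. Qed.
Lemma rowcntS M v q : rowcnt M v q.+1 = rowcnt M v q + M v q. Proof. exact: cntS. Qed.
Lemma colcnt0 M c : colcnt M c 0 = 0. Proof. exact: cnt0. Qed.
Lemma rowcnt0 M v : rowcnt M v 0 = 0. Proof. exact: cnt0. Qed.

Lemma colcnt_pull M i x c y : ~~ M x i -> M x i.+1 ->
  colcnt (pull M i x) c y + ((c == i.+1) && (x < y)) = colcnt M c y + ((c == i) && (x < y)).
Proof.
move=> h0 h1; elim: y => [|y IH]; first by rewrite !colcnt0 !ltn0 !andbF.
rewrite !colcntS pullE; have [e|ne] := eqVneq y x.
  subst y; have [ei|nei] := eqVneq c i; first by subst c; move: h0 IH; lia.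
  by have [ei|nei'] := eqVneq c i.+1; [subst c; move: h1 IH|move: IH]; lia.
by have -> : (x < y.+1) = (x < y); lia.
Qed.

Lemma rowcnt_pull M i x v q : ~~ M x i -> M x i.+1 ->
  rowcnt (pull M i x) v q = rowcnt M v q + ((v == x) && (q == i.+1)).
Proof.
move=> h0 h1; elim: q => [|q IH]; first by rewrite !rowcnt0; lia.
rewrite !rowcntS IH pullE; have [e|ne] := eqVneq v x; last by lia.
subst v; have [ei|nei] := eqVneq q i; first by subst q; move: h0; lia.
by have [ei|nei'] := eqVneq q i.+1; [subst q; move: h1|]; lia.
Qed.

(** In the bracket matching of the columns i and i + 1, the difference
    [colcnt M i y - colcnt M i.+1 y] attains its first minimum right after
    the largest unmatched value x of column i + 1. The two inequalities are this
    description of x; they force x to lie in column i + 1 only. *)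
Definition raisable M i x :=
  (forall y, y <= x -> colcnt M i x.+1 + colcnt M i.+1 y < colcnt M i y + colcnt M i.+1 x.+1) /\
  (forall y, x < y -> colcnt M i x.+1 + colcnt M i.+1 y <= colcnt M i y + colcnt M i.+1 x.+1).

(** The analogue for the values a and a + 1: the difference
    [rowcnt M a q - rowcnt M a.+1 q] attains its maximum for the last time at
    q = p. The entry a + 1 of column p is then the one that the crystal operator
    on values turns into a. *)
Definition vraisable M a p :=
  (forall q, q <= p -> rowcnt M a q + rowcnt M a.+1 p <= rowcnt M a p + rowcnt M a.+1 q) /\
  (forall q, p < q -> rowcnt M a q + rowcnt M a.+1 p < rowcnt M a p + rowcnt M a.+1 q).

Definition vpull M a p : mat := tr (pull (tr M) a p).

Lemma vpullE M a p v c : vpull M a p v c =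
  (M v c && ~~ ((c == p) && (v == a.+1))) || ((c == p) && (v == a)).
Proof. by []. Qed.

Lemma raisableE M i x : raisable M i x -> M x i = false /\ M x i.+1 = true.
Proof.
by case=> /(_ x (leqnn x)) + _; rewrite !colcntS; case: (M x i); case: (M x i.+1); lia.
Qed.

Lemma vraisableE M a p : vraisable M a p -> M a p = false /\ M a.+1 p = true.
Proof.
by case=> _ /(_ p.+1 (ltnSn p)); rewrite !rowcntS; case: (M a p); case: (M a.+1 p); lia.
Qed.

Lemma colcnt_vpull M a p c y : ~~ M a p -> M a.+1 p ->
  colcnt (vpull M a p) c y = colcnt M c y + ((c == p) && (y == a.+1)).
Proof. move=> h0 h1; exact: (@rowcnt_pull (tr M) a p c y). Qed.

Lemma rowcnt_vpull M a p v q : ~~ M a p -> M a.+1 p ->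
  rowcnt (vpull M a p) v q + ((v == a.+1) && (p < q)) = rowcnt M v q + ((v == a) && (p < q)).
Proof. move=> h0 h1; exact: (@colcnt_pull (tr M) a p v q). Qed.

Lemma matP (M N : mat) : (forall v c, M v c = N v c) -> M = N.
Proof. by move=> h; apply/funext => v; apply/funext => c. Qed.

(** Only the count of column p below a + 1 changes. For p = i + 1 the difference
    of the columns i and i + 1 drops by one there, but it is then already as small
    one step before or one step after, so its first minimum does not move. *)
Lemma raisable_vpull M i x a p : raisable M i x -> vraisable M a p ->
  ~~ ((p == i) && (x == a)) -> ~~ ((p == i.+1) && (x == a.+1)) ->
  raisable (vpull M a p) i x.
Proof.
move=> hE hV N1 N2; have [h0 h1] := raisableE hE; have [k0 k1] := vraisableE hV.
have Cv c y := colcnt_vpull c y (negbT k0) k1.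
have [E1 E2] := hE.
have [epi|npi] := eqVneq p i.+1; last first.
  have hx : (i == p) && (x.+1 == a.+1) = false by lia.
  have hx' : (i.+1 == p) = false by lia.
  by split=> y hy; rewrite !Cv hx hx' !addn0; [have := E1 y hy|have := E2 y hy]; lia.
subst p; have nxa : x != a by apply/eqP => e; move: h1 k0; rewrite e => ->.
have hx : (i == i.+1) = false by lia.
have hx' : (x.+1 == a.+1) = false by lia.
have c1 := colcntS M i a; have c2 := colcntS M i.+1 a.
have c3 := colcntS M i a.+1; have c4 := colcntS M i.+1 a.+1.
rewrite k0 in c2; rewrite k1 in c4.
have hFi : M a i || ~~ M a.+1 i.
  by have [/(_ i (leqnSn i)) + _] := hV; rewrite !rowcntS; lia.
clear hE hV k0 k1 h0 h1.
split=> y hy; rewrite !Cv hx hx' eqxx /= !addn0.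
  have [e|ne] := eqVneq y a.+1; last by rewrite addn0; exact: E1.
  subst y; have := E1 a; have := E1 a.+2; lia.
have [e|ne] := eqVneq y a.+1; last by rewrite addn0; exact: E2.
subst y; have := E2 a; have := E2 a.+2; lia.
Qed.

(** Mirror image of the preceding lemma: the moved entry can raise the
    difference of rows a and a + 1 only at q = i + 1, where a neighbouring position
    already reaches the new value. *)
Lemma vraisable_pull M i x a p : raisable M i x -> vraisable M a p ->
  ~~ ((p == i) && (x == a)) -> ~~ ((p == i.+1) && (x == a.+1)) ->
  vraisable (pull M i x) a p.
Proof.
move=> hE hV N1 N2; have [h0 h1] := raisableE hE; have [k0 k1] := vraisableE hV.
have Rp v q := rowcnt_pull v q (negbT h0) h1.
have [V1 V2] := hV.
have [epi|npi] := eqVneq x a; last first.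
  have hx : (a.+1 == x) && (p == i.+1) = false by lia.
  have hx' : (a == x) = false by lia.
  by split=> q hq; rewrite !Rp hx hx' !addn0; [have := V1 q hq|have := V2 q hq]; lia.
subst x; have npi : p != i.+1 by apply/eqP => e; move: h1 k0; rewrite -e => ->.
have hx : (a.+1 == a) = false by lia.
have hx' : (p == i.+1) = false by lia.
have c1 := rowcntS M a i; have c2 := rowcntS M a.+1 i.
have c3 := rowcntS M a i.+1; have c4 := rowcntS M a.+1 i.+1.
rewrite h0 in c1; rewrite h1 in c3.
have hFi : M a.+1 i || ~~ M a.+1 i.+1.
  by have [_ /(_ a.+2 (leqnSn _))] := hE; rewrite !colcntS; lia.
clear hE hV k0 k1 h0 h1.
split=> q hq; rewrite !Rp hx hx' eqxx /= !addn0.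
  have [e|ne] := eqVneq q i.+1; last by rewrite addn0; exact: V1.
  subst q; have := V1 i; have := V1 i.+2; lia.
have [e|ne] := eqVneq q i.+1; last by rewrite addn0; exact: V2.
subst q; have := V2 i; have := V2 i.+2; lia.
Qed.

(** The crystal structures on columns and on values commute. Only a move of both
    kinds inside the same 2 x 2 block of rows a, a + 1 and columns i, i + 1 can
    shift the place where the other operator acts. *)
Lemma raisable_commute M i x a p : raisable M i x -> vraisable M a p ->
  exists x' p', [/\ vraisable (pull M i x) a p', raisable (vpull M a p) i x'
                  & vpull (pull M i x) a p' = pull (vpull M a p) i x'].
Proof.
move=> hE hV; have [h0 h1] := raisableE hE; have [k0 k1] := vraisableE hV.
have Rp v q := rowcnt_pull v q (negbT h0) h1.
have Cv c y := colcnt_vpull c y (negbT k0) k1.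
have fE v c : (v == x) && (c == i.+1) -> M v c by case/andP=> /eqP-> /eqP->.
have fE0 v c : (v == x) && (c == i) -> ~~ M v c by case/andP=> /eqP-> /eqP->; rewrite h0.
have fV v c : (v == a.+1) && (c == p) -> M v c by case/andP=> /eqP-> /eqP->; rewrite k1.
have fV0 v c : (v == a) && (c == p) -> ~~ M v c by case/andP=> /eqP-> /eqP->; rewrite k0.
have [E1 E2] := hE; have [V1 V2] := hV.
have c1 := colcntS M i a; have c2 := colcntS M i.+1 a.
have c3 := colcntS M i a.+1; have c4 := colcntS M i.+1 a.+1.
have r1 := rowcntS M a i; have r2 := rowcntS M a.+1 i.
have r3 := rowcntS M a i.+1; have r4 := rowcntS M a.+1 i.+1.
have F1 := V1 i; have F2' := V2 i.+1; have F3' := V2 i.+2.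
have G1 := E1 a; have G2' := E2 a.+1; have G3' := E2 a.+2.
(* the rows a, a+1 and columns i, i+1 form the block 0 1 / 1 1, and both orders
   of moves give 1 1 / 1 0 *)
have [/andP[/eqP epi /eqP exa]|N1] := boolP ((p == i) && (x == a)).
  subst p x; exists a.+1, i.+1; split.
  - by split=> q hq; rewrite !Rp; have := V1 q; have := V2 q; lia.
  - by split=> y hy; rewrite !Cv; have := E1 y; have := E2 y; lia.
  apply: matP => v c.
  by rewrite vpullE !pullE vpullE; have := fE v c; have := fV v c; lia.
(* here the block is 0 0 / 0 1, and both orders of moves give 1 0 / 0 0 *)
have [/andP[/eqP epi /eqP exa]|N2] := boolP ((p == i.+1) && (x == a.+1)).
  subst p x; exists a, i; split.
  - by split=> q hq; rewrite !Rp; have := V1 q; have := V2 q; lia.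
  - by split=> y hy; rewrite !Cv; have := E1 y; have := E2 y; lia.
  apply: matP => v c.
  by rewrite vpullE !pullE vpullE; have := fE0 v c; have := fV0 v c; lia.
exists x, p; split; [exact: vraisable_pull|exact: raisable_vpull|].
apply: matP => v c; rewrite vpullE !pullE vpullE.
move/implyP: (fE0 v c); move/implyP: (fV0 v c).
move/implyP: (fE v c); move/implyP: (fV v c); rewrite !(andbC (c == p)).
by case: ((v == x) && (c == i)); case: ((v == x) && (c == i.+1));
   case: ((v == a) && (c == p)); case: ((v == a.+1) && (c == p)); case: (M v c).
Qed.

(** * Uniqueness of the straight end of a raising sequence *)

Lemma first_argmin (g : nat -> nat) N : exists y, [/\ y <= N,
  forall y', y' < y -> g y < g y' & forall y', y' <= N -> g y <= g y'].
Proof.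
elim: N => [|N [y [h1 h2 h3]]].
  by exists 0; split=> // y'; rewrite leqn0 => /eqP->.
have [lt|ge] := ltnP (g N.+1) (g y).
  exists N.+1; split=> // y' hy'; first by have := h3 y'; lia.
  by have [->|ne] := eqVneq y' N.+1; [|have := h3 y'; lia].
exists y; split=> //; first by lia.
by move=> y' hy'; have [->|ne] := eqVneq y' N.+1; [|apply: h3; lia].
Qed.

Lemma last_argmin (g : nat -> nat) N : exists y, [/\ y <= N,
  forall y', y < y' <= N -> g y < g y' & forall y', y' <= N -> g y <= g y'].
Proof.
have [y [h1 h2 h3]] := first_argmin (fun z => g (N - z)) N.
exists (N - y); split=> [|y' hy'|y' hy']; first by lia.
  have := h2 (N - y'); rewrite (_ : N - (N - y') = y'); [apply|]; lia.
by have := h3 (N - y'); rewrite (_ : N - (N - y') = y'); [apply|]; lia.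
Qed.

Definition supp n m (M : mat) := forall v c, M v c -> v < n /\ c < m.

Section Matrices.
Variables n m : nat.

Lemma colcnt_supp M c y : supp n m M -> n <= y -> colcnt M c y = colcnt M c n.
Proof. by move=> h; apply: cnt_stable => v /h []. Qed.
Lemma rowcnt_supp M v q : supp n m M -> m <= q -> rowcnt M v q = rowcnt M v m.
Proof. by move=> h; apply: cnt_stable => c /h []. Qed.

Lemma colcnt_bound M c y : supp n m M -> colcnt M c y <= n.
Proof.
have := cnt_le (fun v => M v c) (leq0n (minn y n)); rewrite cnt0 => h s.
by case: (leqP y n) => hy; [|rewrite (colcnt_supp _ s (ltnW hy))]; rewrite /colcnt; move: h;
  [rewrite (minn_idPl hy)|rewrite (minn_idPr (ltnW hy))]; lia.
Qed.

Lemma rowcnt_bound M v q : supp n m M -> rowcnt M v q <= m.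
Proof.
have := cnt_le (M v) (leq0n (minn q m)); rewrite cnt0 => h s.
by case: (leqP q m) => hy; [|rewrite (rowcnt_supp _ s (ltnW hy))]; rewrite /rowcnt; move: h;
  [rewrite (minn_idPl hy)|rewrite (minn_idPr (ltnW hy))]; lia.
Qed.

Lemma colcnt_out M c y : supp n m M -> m <= c -> colcnt M c y = 0.
Proof.
move=> h hc; elim: y => [|y IH]; first exact: colcnt0.
by rewrite colcntS IH; case E: (M y c) => //; have [] := h _ _ E; lia.
Qed.

Lemma supp_pull M i x : supp n m M -> raisable M i x -> supp n m (pull M i x).
Proof.
move=> h hE v c; have [_ h1] := raisableE hE; have [a b] := h _ _ h1.
rewrite pullE => /orP[/andP[/h //]|/andP[/eqP-> /eqP->]]; lia.
Qed.

Lemma supp_vpull M a p : supp n m M -> vraisable M a p -> supp n m (vpull M a p).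
Proof.
move=> h hE v c; have [_ h1] := vraisableE hE; have [k l] := h _ _ h1.
rewrite vpullE => /orP[/andP[/h //]|/andP[/eqP-> /eqP->]]; lia.
Qed.

Lemma raisable_ex M i y : supp n m M -> colcnt M i y < colcnt M i.+1 y ->
  exists x, raisable M i x.
Proof.
move=> h hy.
have B z : colcnt M i.+1 z <= n by exact: colcnt_bound.
have [z [z1 z2 z3]] := first_argmin (fun y => colcnt M i y + (n - colcnt M i.+1 y)) n.
have z4 y' : colcnt M i z + colcnt M i.+1 y' <= colcnt M i y' + colcnt M i.+1 z.
  case: (leqP y' n) => hy'; last rewrite !(colcnt_supp _ h (ltnW hy')).
    by have := z3 y' hy'; have := B y'; have := B z; lia.
  by have := z3 n (leqnn _); have := B n; have := B z; lia.
case: z => [|x] in z1 z2 z3 z4; first by have := z4 y; rewrite !colcnt0; lia.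
exists x; split=> y' hy'; last exact: z4.
by have := z2 y' hy'; have := B y'; have := B x.+1; lia.
Qed.

(** The matrices of straight tableaux: weakly increasing rows mean that each
    column has, below any bound, at least as many entries as the next one. *)
Definition straight M := forall i y, colcnt M i.+1 y <= colcnt M i y.

(** No operator on values applies: the difference of rows a and a + 1 is maximal
    at the right end. *)
Definition vtop M := forall a q,
  rowcnt M a q + rowcnt M a.+1 m <= rowcnt M a m + rowcnt M a.+1 q.

Lemma vraisable_ex M : supp n m M -> ~ vtop M -> exists a p, vraisable M a p.
Proof.
move=> h /existsNP [a /existsNP [q /negP hq]]; exists a.
have B z : rowcnt M a z <= m by exact: rowcnt_bound.
have [p [z1 z2 z3]] := last_argmin (fun z => rowcnt M a.+1 z + (m - rowcnt M a z)) m.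
have z4 y' : rowcnt M a y' + rowcnt M a.+1 p <= rowcnt M a p + rowcnt M a.+1 y'.
  case: (leqP y' m) => hy'; last rewrite !(rowcnt_supp _ h (ltnW hy')).
    by have := z3 y' hy'; have := B y'; have := B p; lia.
  by have := z3 m (leqnn _); have := B m; have := B p; lia.
have pm : p < m.
  by rewrite ltn_neqAle z1 andbT; apply/eqP => e; have := z4 q; rewrite e; lia.
exists p; split=> y' hy'; first exact: z4.
case: (leqP y' m) => hm; last rewrite !(rowcnt_supp _ h (ltnW hm)).
  by have := z2 y'; have := B y'; have := B p; lia.
by have := z2 m; have := B m; have := B p; lia.
Qed.

(** Column p gets one more value below a + 1. The column before it has room for
    that: by the choice of p it contains a or lacks a + 1. *)
Lemma straight_vpull M a p : straight M -> vraisable M a p -> straight (vpull M a p).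
Proof.
move=> s hV i y; have [k0 k1] := vraisableE hV.
rewrite !(colcnt_vpull _ _ (negbT k0) k1); have sy := s i y.
have [/andP[/eqP e /eqP e']|] := boolP ((i.+1 == p) && (y == a.+1)); last by lia.
subst p y; have [/(_ i (leqnSn i)) + _] := hV.
have s1 := s i a; have s2 := s i a.+2; move: s2 sy.
by rewrite !colcntS !rowcntS; lia.
Qed.

Lemma vtop_pull M i x : supp n m M -> vtop M -> raisable M i x -> vtop (pull M i x).
Proof.
move=> h t hE a q; have [h0 h1] := raisableE hE; have [_ im] := h _ _ h1.
rewrite !(rowcnt_pull _ _ (negbT h0) h1) (_ : (m == i.+1) = false) ?andbF ?addn0; last by lia.
have tq := t a q.
have [/andP[/eqP e /eqP e']|] := boolP ((a == x) && (q == i.+1)); last by lia.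
subst x q; have [_ /(_ a.+2 (leqnSn _))] := hE.
have s1 := t a i; have s2 := t a i.+2; move: s2 tq.
by rewrite !colcntS !rowcntS; lia.
Qed.

(** The position p can be read off after the move, when the difference of rows
    a and a + 1 attains its maximum for the first time at p + 1. *)
Lemma vpull_inj M N a p q : vraisable M a p -> vraisable N a q ->
  vpull M a p = vpull N a q -> M = N.
Proof.
move=> hM hN e; have [k0 k1] := vraisableE hM; have [l0 l1] := vraisableE hN.
have rM v z := rowcnt_vpull v z (negbT k0) k1.
have rN v z := rowcnt_vpull v z (negbT l0) l1.
have epq : p = q.
  rewrite -e in rN; have := (rM a p.+1, rM a.+1 p.+1, rN a p.+1, rN a.+1 p.+1).
  have := (rM a q.+1, rM a.+1 q.+1, rN a q.+1, rN a.+1 q.+1).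
  have [A1 A2] := hM; have [B1 B2] := hN.
  have := (rM a p, rM a.+1 p, rN a p, rN a.+1 p).
  have := (rM a q, rM a.+1 q, rN a q, rN a.+1 q).
  have h1 : (a == a.+1) = false by lia.
  have h2 : (a.+1 == a) = false by lia.
  rewrite !h1 !h2 !eqxx !andFb !andTb !addn0.
  move=> [[[? ?] ?] ?] [[[? ?] ?] ?] [[[? ?] ?] ?] [[[? ?] ?] ?].
  have := rowcntS M a p; have := rowcntS M a.+1 p.
  have := rowcntS N a q; have := rowcntS N a.+1 q.
  rewrite k0 k1 l0 l1 => ? ? ? ?.
  case: (ltngtP p q) => // lt.
    by have := A2 q lt; have := A2 q.+1; have := B1 p; have := B1 p.+1; lia.
  by have := B2 p lt; have := B2 p.+1; have := A1 q; have := A1 q.+1; lia.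
subst q; apply: matP => v c; have := congr1 (fun M => M v c) e; rewrite !vpullE.
have [->|nc] := eqVneq c p; last by rewrite /= !andbT !orbF.
have [->|nv] := eqVneq v a; first by rewrite k0 l0.
have [->|nv'] := eqVneq v a.+1; first by rewrite k1 l1.
by rewrite /= !andbT !orbF.
Qed.

Inductive raises (M : mat) : mat -> Prop :=
| raises_refl : raises M M
| raises_step i x N : raisable M i x -> raises (pull M i x) N -> raises M N.

Lemma raises_trans M N P : raises M N -> raises N P -> raises M P.
Proof. by elim=> // {}M i x {}N h _ IH /IH; exact: raises_step. Qed.

Lemma raises_supp M N : raises M N -> supp n m M -> supp n m N.
Proof. by elim=> // {}M i x {}N h _ IH s; apply: IH; exact: supp_pull. Qed.

Lemma raises_rowcnt M N : supp n m M -> raises M N -> forall v, rowcnt N v m = rowcnt M v m.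
Proof.
move=> s r; elim: r s => // {}M i x {}N h _ IH s v; rewrite IH; last exact: supp_pull.
have [h0 h1] := raisableE h; have [_ hm] := s _ _ h1.
by rewrite (rowcnt_pull _ _ (negbT h0) h1); lia.
Qed.

Lemma raises_vtop M N : supp n m M -> vtop M -> raises M N -> vtop N.
Proof.
move=> s t r; elim: r s t => // {}M i x {}N h _ IH s t.
by apply: IH; [exact: supp_pull|exact: vtop_pull].
Qed.

Lemma raises_vraisable M N a p : raises M N -> vraisable M a p ->
  exists2 q, vraisable N a q & raises (vpull M a p) (vpull N a q).
Proof.
move=> r; elim: r p => [{}M p h|{}M i x {}N h _ IH p h'].
  by exists p => //; exact: raises_refl.
have [x' [p' [A B C]]] := raisable_commute h h'.
have [q hq hr] := IH _ A; exists q => //.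
by apply: (raises_step B); rewrite -C.
Qed.

(** These matrices are those of the superstandard tableaux, with all entries of
    row v equal to v: by [vtop] an entry v + 1 needs an entry v above it, and by
    straightness it then needs an entry v + 1 to its left. *)
Lemma straight_top_initial M : supp n m M -> straight M -> vtop M ->
  forall v c, M v c -> forall c', c' <= c -> M v c'.
Proof.
move=> h s t.
have key : forall v, (forall c, M v c.+1 -> M v c) /\
                     (forall c u, M v c -> u <= v -> M u c).
  elim=> [|v [IH1 IH2]].
    split=> [c|c u hc]; last by rewrite leqn0 => /eqP->.
    by have := s c 1; rewrite !colcntS !colcnt0; lia.
  have up c : M v.+1 c -> M v c.
    move=> hc; apply: contrapT => /negP nc.
    have z d : c <= d -> ~~ M v d.
      by move=> /subnKC <-; elim: (d - c) => [|k nk]; rewrite ?addn0 // addnS;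
         apply: contra nk; exact: IH1.
    have := t v c; have [_ cm] := h _ _ hc.
    have -> : rowcnt M v m = rowcnt M v c.
      rewrite -(subnKC (ltnW cm)); elim: (m - c) => [|k IH]; rewrite ?addn0 // addnS rowcntS IH.
      by rewrite (negbTE (z _ (leq_addr _ _))) addn0.
    by have := cnt_mono (M v.+1) cm; rewrite -/(rowcnt _ _ _) -/(rowcnt _ _ _) rowcntS hc; lia.
  have full c u : M v.+1 c -> u <= v.+1 -> M u c.
    move=> hc; rewrite leq_eqVlt => /orP[/eqP->//|hu]; apply: (IH2 c u); [exact: up|lia].
  split=> // c hc; apply: contrapT => /negP nc.
  have f u : u <= v.+2 -> colcnt M c.+1 u = u.
    elim: u => [|u IHu hu]; first by rewrite colcnt0.
    by rewrite colcntS IHu ?(full c.+1 u hc); lia.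
  have := s c v.+2; rewrite (f _ (leqnn _)) colcntS (negbTE nc).
  by have := cnt_le (fun v => M v c) (leq0n v.+1); rewrite cnt0 /colcnt; lia.
move=> v c; elim: c => [|c IH] hc c'; first by rewrite leqn0 => /eqP->.
by rewrite leq_eqVlt => /orP[/eqP->//|]; apply: IH; exact: (key v).1.
Qed.

Lemma initial_cnt (p : nat -> bool) q : (forall c, p c -> forall c', c' <= c -> p c') ->
  forall c, c < q -> p c = (c < cnt p q).
Proof.
move=> h; elim: q => // q IH c hc; rewrite cntS.
have e : c < q -> p c = (c < cnt p q) by exact: IH.
have full : p q -> cnt p q = q.
  move=> pq; suff : q <= cnt p q by have := cnt_le p (leq0n q); rewrite cnt0; lia.
  by case: q {e hc} IH pq => // q IH pq; rewrite -IH //; exact: h pq _ _.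
have [cq|cq] := ltnP c q.
  by rewrite (e cq); case E: (p q); rewrite ?(full E) ?addn0 //; lia.
have -> : c = q by lia.
case E: (p q); first by rewrite (full E); lia.
by have := cnt_le p (leq0n q); rewrite cnt0; lia.
Qed.

Lemma straight_top_unique M N : supp n m M -> supp n m N ->
  straight M -> straight N -> vtop M -> vtop N ->
  (forall v, rowcnt M v m = rowcnt N v m) -> M = N.
Proof.
move=> sM sN tM tN vM vN e; apply: matP => v c.
have [cm|cm] := ltnP c m; last first.
  by case E: (M v c); [have := sM _ _ E|case F: (N v c) => //; have := sN _ _ F]; lia.
rewrite (initial_cnt (@straight_top_initial _ sM tM vM v) cm).
by rewrite (initial_cnt (@straight_top_initial _ sN tN vN v) cm) -/(rowcnt M v m) e.
Qed.

(** A bounded potential that grows with each raising of values. *)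
Definition vpot M := \sum_(c < m) \sum_(y < n.+1) colcnt M c y.

Lemma sum_ord_bound k b (F : 'I_k -> nat) : (forall i, F i <= b) -> \sum_(i < k) F i <= k * b.
Proof.
by move=> h; rewrite -[X in X * _]card_ord -sum_nat_const; apply: leq_sum => i _.
Qed.

Lemma vpot_bound M : supp n m M -> vpot M <= m * (n.+1 * n).
Proof. by move=> s; do 2 apply: sum_ord_bound => ?; exact: colcnt_bound. Qed.

Lemma vpot_vpull M a p : supp n m M -> vraisable M a p -> vpot M < vpot (vpull M a p).
Proof.
move=> s h; have [k0 k1] := vraisableE h; have [an pm] := s _ _ k1.
have e c y := colcnt_vpull c y (negbT k0) k1.
rewrite /vpot (bigD1 (Ordinal pm)) // [X in _ < X](bigD1 (Ordinal pm)) //=.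
rewrite -addSn leq_add //; last first.
  by apply: leq_sum => c _; apply: leq_sum => y _; rewrite e leq_addr.
have an' : a.+1 < n.+1 by lia.
rewrite (bigD1 (Ordinal an')) // [X in _ < X](bigD1 (Ordinal an')) //=.
by rewrite -addSn leq_add // ?e ?eqxx /= ?addn1 //; apply: leq_sum => y _; rewrite e leq_addr.
Qed.

(** Induction on the number of possible raisings of values. As long as M can be
    raised, so can its two ends, along commuting squares, and raising is
    injective. If M cannot be raised, neither can the ends, which are then
    determined by how often each value occurs, as in M. *)
Theorem straight_unique M N P : supp n m M -> raises M N -> raises M P ->
  straight N -> straight P -> N = P.
Proof.
move: {2}(m * (n.+1 * n) - vpot M) (leqnn (m * (n.+1 * n) - vpot M)) => k.
elim: k M N P => [|k IH] M N P hk s rN rP sN sP;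
  (have [t|/(vraisable_ex s) [a [p h]]] := pselect (vtop M);
   [by apply: straight_top_unique => //; rewrite ?raises_rowcnt //; do ?exact: raises_supp rN s;
     do ?exact: raises_supp rP s; do ?exact: raises_vtop s t _;
     move=> v; rewrite !(raises_rowcnt s) |]).
  by have := vpot_vpull s h; have := vpot_bound (supp_vpull s h); lia.
have [q hq rq] := raises_vraisable rN h; have [q' hq' rq'] := raises_vraisable rP h.
apply: (vpull_inj hq hq'); apply: (IH (vpull M a p)) => //; try exact: straight_vpull.
  by have := vpot_vpull s h; have := vpot_bound (supp_vpull s h); lia.
exact: supp_vpull.
Qed.

End Matrices.

(** * Frank matrices and their last column *)

Section Frank.
Variables n m : nat.

(** A bounded potential that grows with each raising of columns. *)
Definition rpot (M : mat) := \sum_(v < n) \sum_(q < m.+1) rowcnt M v q.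

Lemma rpot_bound M : supp n m M -> rpot M <= n * (m.+1 * m).
Proof. by move=> s; do 2 apply: sum_ord_bound => ?; exact: rowcnt_bound s. Qed.

Lemma rpot_pull M i x : supp n m M -> raisable M i x -> rpot M < rpot (pull M i x).
Proof.
move=> s h; have [k0 k1] := raisableE h; have [xn im] := s _ _ k1.
have e v q := rowcnt_pull v q (negbT k0) k1.
rewrite /rpot (bigD1 (Ordinal xn)) // [X in _ < X](bigD1 (Ordinal xn)) //=.
rewrite -addSn leq_add //; last first.
  by apply: leq_sum => c _; apply: leq_sum => y _; rewrite e leq_addr.
have im' : i.+1 < m.+1 by lia.
rewrite (bigD1 (Ordinal im')) // [X in _ < X](bigD1 (Ordinal im')) //=.
by rewrite -addSn leq_add // ?e ?eqxx /= ?addn1 //; apply: leq_sum => y _; rewrite e leq_addr.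
Qed.

Lemma rpot_raises M N : supp n m M -> raises M N -> M = N \/ rpot M < rpot N.
Proof.
move=> s r; elim: r s => [|{}M i x {}N h _ IH s]; first by left.
by right; have := rpot_pull s h; case: (IH (supp_pull s h)) => [<-|]; lia.
Qed.

Lemma raises_straight_ex M : supp n m M -> exists2 N, raises M N & straight N.
Proof.
move: {2}(n * (m.+1 * m) - rpot M) (leqnn (n * (m.+1 * m) - rpot M)) => k.
elim: k M => [|k IH] M hk s;
  (have [t|/existsNP[i /existsNP[y /negP hy]]] := pselect (straight M);
    [by exists M => //; exact: raises_refl|]);
  (have [x hx] : exists x, raisable M i x by apply: (@raisable_ex n m _ _ y) => //; lia);
  have := rpot_pull s hx; have := rpot_bound (supp_pull s hx).
  by lia.
move=> h1 h2; have [||N rN sN] := IH (pull M i x); [lia|exact: supp_pull|].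
by exists N => //; exact: raises_step rN.
Qed.

(** Confluence: the straight end can still be reached after any detour. *)
Lemma raises_to_straight M N T : supp n m M -> raises M T -> straight T ->
  raises M N -> raises N T.
Proof.
move=> s rT sT rN; have [U rU sU] := raises_straight_ex (raises_supp rN s).
by rewrite (straight_unique s rT (raises_trans rN rU) sT sU).
Qed.

Lemma colcnt_pullL M i x y : raisable M i x -> colcnt (pull M i x) i y = colcnt M i y + (x < y).
Proof.
by move=> h; have [k0 k1] := raisableE h; have := colcnt_pull i y (negbT k0) k1; lia.
Qed.
Lemma colcnt_pullR M i x y : raisable M i x ->
  colcnt (pull M i x) i.+1 y + (x < y) = colcnt M i.+1 y.
Proof.
by move=> h; have [k0 k1] := raisableE h; have := colcnt_pull i.+1 y (negbT k0) k1; lia.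
Qed.

(** If column i + 1 has at least s unmatched values, s of them can be moved to
    column i. The last clause concerns exactly s unmatched values. They are all
    smaller than z, since they are moved in decreasing order and the first minimum
    of the difference comes no later than z. So column i, when it has
    received them all, has below any bound at least as many values as column i + 1
    had before. *)
Lemma raise_many s M i z : supp n m M -> colcnt M i z + s <= colcnt M i.+1 z -> exists N,
  [/\ raises M N, forall v c, c != i -> c != i.+1 -> N v c = M v c,
      colcnt N i n = colcnt M i n + s, colcnt N i.+1 n + s = colcnt M i.+1 n
    & (forall y, colcnt M i.+1 y <= colcnt M i y + s) ->
      (forall y, z <= y -> colcnt M i y + s <= colcnt N i y) /\
      (forall y, colcnt M i.+1 y <= colcnt N i y)].
Proof.
elim: s M z => [|s IH] M z h hz.
  exists M; split; rewrite ?addn0 //; first exact: raises_refl.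
  by move=> a; split=> y; have := a y; rewrite !addn0.
have [x hx] : exists x, raisable M i x by apply: (@raisable_ex n m _ _ z) => //; lia.
have [E1 E2] := hx; have [k0 k1] := raisableE hx; have [xn _] := h _ _ k1.
have emin y : colcnt M i x.+1 + colcnt M i.+1 y <= colcnt M i y + colcnt M i.+1 x.+1.
  by have := E1 y; have := E2 y; lia.
have cx : colcnt M i x.+1 = colcnt M i x by rewrite colcntS k0; lia.
have cx' : colcnt M i.+1 x.+1 = (colcnt M i.+1 x).+1 by rewrite colcntS k1; lia.
have pL y := colcnt_pullL y hx; have pR y := colcnt_pullR y hx.
have [||N [r a1 a2 a3 a4]] := IH (pull M i x) x; first exact: supp_pull.
  by have := emin z; rewrite pL; have := pR x; rewrite ltnn; lia.
exists N; split.
- exact: raises_step r.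
- move=> v c c1 c2; rewrite a1 // pullE (negbTE c1) (negbTE c2) !andbF orbF andbT //.
- by rewrite a2 pL xn; lia.
- by have := pR n; rewrite xn; lia.
move=> g; have [|b1 b2] := a4.
  by move=> y; have := g y; have := E1 y; have := E2 y; have := g x.+1; have := pR y;
     rewrite pL; lia.
have b3 y : x < y -> colcnt M i y + s.+1 <= colcnt N i y.
  by move=> hy; have := b1 y; rewrite pL hy; lia.
split=> y.
  move=> zy; apply: b3; apply: leq_trans zy.
  by rewrite ltnNge; apply/negP => zx; have := E1 _ zx; have := g x.+1; lia.
have [yx|xy] := leqP y x; last by have := b3 y xy; have := g y; lia.
by have := b2 y; have := pR y; lia.
Qed.

(** For all h together these numbers determine the multiset of nonzero column
    lengths. Each is a sum of values of a convex function of the column lengths,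
    and therefore cannot drop when two lengths move apart. *)
Definition excess h (M : mat) := \sum_(c < m) (colcnt M c n - h).

Lemma excess_change h i M N : i.+1 < m ->
  (forall v c, c != i -> c != i.+1 -> N v c = M v c) ->
  excess h N + (colcnt M i n - h) + (colcnt M i.+1 n - h) =
  excess h M + (colcnt N i n - h) + (colcnt N i.+1 n - h).
Proof.
move=> im e; have im' : i < m by lia.
have ne : Ordinal im != Ordinal im' by apply/eqP => /(congr1 val) /=; lia.
rewrite /excess (bigD1 (Ordinal im')) // (bigD1 (Ordinal im)) //=.
rewrite [X in _ = X + _ + _](bigD1 (Ordinal im')) //.
rewrite [X in _ = _ + X + _ + _](bigD1 (Ordinal im)) //=.
rewrite (eq_bigr (fun c : 'I_m => colcnt M c n - h)); first by lia.
move=> c /andP[c1 c2]; congr (_ - _); by apply: eq_cnt => v _; rewrite e.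
Qed.

Lemma height_lt M i : supp n m M -> colcnt M i.+1 n > 0 -> i.+1 < m.
Proof. by move=> s; case: (ltnP i.+1 m) => // /(colcnt_out n s) ->. Qed.

(** If some column is shorter than its right neighbour, exchange the two lengths
    by raisings, which does not change the excess. Otherwise the lengths are
    decreasing and every raising moves two of them apart. *)
Theorem excess_raises h M T : supp n m M -> raises M T -> straight T ->
  excess h M <= excess h T.
Proof.
move: {2}(n * (m.+1 * m) - rpot M) (leqnn (n * (m.+1 * m) - rpot M)) => k.
elim: k M => [|k IH] M hk s r sT.
  case: r sT => // i x N hx _ _.
  by have := rpot_pull s hx; have := rpot_bound (supp_pull s hx); lia.
have step N : raises M N -> M <> N -> excess h M <= excess h N -> excess h M <= excess h T.
  move=> rN ne le; apply: leq_trans le _; have sN := raises_supp rN s.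
  apply: IH => //; last exact: raises_to_straight rN.
  by case: (rpot_raises s rN) => // lt; have := rpot_bound sN; lia.
have [[i hi]|/forallNP dec] := pselect (exists i, colcnt M i n < colcnt M i.+1 n).
  have im : i.+1 < m by apply: (height_lt s); lia.
  have [|N [rN e a b _]] := @raise_many (colcnt M i.+1 n - colcnt M i n) M i n s; first by lia.
  by apply: (step N) => // [eMN|]; [rewrite -eMN in a|have := excess_change h im e]; lia.
case: r sT step => // i x N hx rN sT step.
have [k0 k1] := raisableE hx; have [xn im] := s _ _ k1.
apply: (step (pull M i x)).
- by apply: raises_step hx _; exact: raises_refl.
- by move=> e; have := colcnt_pullL n hx; rewrite -e xn; lia.
have := @excess_change h i M (pull M i x) im.
rewrite colcnt_pullL // xn; have := colcnt_pullR n hx; rewrite xn; have /negP := dec i.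
have e : forall v c, c != i -> c != i.+1 -> pull M i x v c = M v c.
  by move=> v c c1 c2; rewrite pullE (negbTE c1) (negbTE c2) !andbF orbF andbT.
by move=> ? ? /(_ e); lia.
Qed.

(** If column i + 1 had more unmatched values than the difference of the two
    lengths, raisings could make column i longer than both columns were, and the
    excess would grow for h the larger of the two lengths. *)
Theorem frank_pair M T i y : supp n m M -> raises M T -> straight T ->
  (forall h, excess h M = excess h T) ->
  colcnt M i.+1 y <= colcnt M i y + (colcnt M i.+1 n - colcnt M i n).
Proof.
move=> s r sT e; rewrite leqNgt; apply/negP => lt.
have [|N [rN eN a b _]] := @raise_many (colcnt M i.+1 n - colcnt M i n).+1 M i y s.
  by lia.
have im : i.+1 < m by apply: (height_lt s); lia.
have := excess_change (maxn (colcnt M i n) (colcnt M i.+1 n)) im eN.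
have := excess_raises (maxn (colcnt M i n) (colcnt M i.+1 n)) (raises_supp rN s)
  (raises_to_straight s r sT rN) sT.
by rewrite -e; lia.
Qed.

(** Exchange the lengths of two adjacent columns as long as the left one is the
    shorter. Column q is only ever exchanged with a shorter column on its left,
    and then it decreases by [raise_many]. When the lengths have become
    decreasing, the matrix is straight by [frank_pair]. *)
Theorem frank_last_column M T q : supp n m M -> raises M T -> straight T ->
  (forall h, excess h M = excess h T) -> (forall c, q < c -> colcnt M c n < colcnt M q n) ->
  exists2 q', colcnt T q' n = colcnt M q n & forall y, colcnt M q y <= colcnt T q' y.
Proof.
move: {2}(n * (m.+1 * m) - rpot M) (leqnn (n * (m.+1 * m) - rpot M)) => k.
elim: k M q => [|k IH] M q hk s r sT e lst.
  case: r sT e => [_ _|i x N hx _ _ _]; first by exists q.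
  by have := rpot_pull s hx; have := rpot_bound (supp_pull s hx); lia.
have [[i hi]|/forallNP dec] := pselect (exists i, colcnt M i n < colcnt M i.+1 n); last first.
  case: r sT e => [_ _|i x N hx rN sT e]; first by exists q.
  have [k0 k1] := raisableE hx; have [xn im] := s _ _ k1.
  have [/(_ 0 (leq0n _))] := hx; rewrite !colcnt0 => lt _.
  have := frank_pair i x.+1 s (raises_step hx rN) sT e; have /negP := dec i; lia.
have im : i.+1 < m by apply: (height_lt s); lia.
have [|N [rN eN a b g]] := @raise_many (colcnt M i.+1 n - colcnt M i n) M i n s; first by lia.
have sN := raises_supp rN s; have rT := raises_to_straight s r sT rN.
have hN c y : c != i -> c != i.+1 -> colcnt N c y = colcnt M c y.
  by move=> c1 c2; apply: eq_cnt => v _; exact: eN.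
have pN : rpot M < rpot N.
  by case: (rpot_raises s rN) => // eMN; rewrite -eMN in a; lia.
have eh h : excess h N = excess h T by have := excess_change h im eN; rewrite -e; lia.
have bN := rpot_bound sN.
have hkN : n * (m.+1 * m) - rpot N <= k by lia.
have IHN q' := IH N q' hkN sN rT sT eh.
have g' : forall y, colcnt M i.+1 y <= colcnt N i y.
  by apply: (g _).2 => y; exact: frank_pair r sT e.
have nqi : q != i by apply/eqP => eq; subst i; have := lst q.+1 (ltnSn q); lia.
have [eqi|nqi'] := eqVneq q i.+1.
  subst q; have [|q' h1 h2] := IHN i.
    move=> c hc; have [->|nc] := eqVneq c i.+1; first by lia.
    by rewrite hN //; [have := lst c|]; lia.
  by exists q'; [lia|move=> y; have := g' y; have := h2 y; lia].
have [|q' h1 h2] := IHN q.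
  move=> c hc; rewrite (hN q) //; have lc := lst c hc.
  have [ci|nc] := eqVneq c i.
    by subst c; have := lst i.+1; lia.
  have [ci'|nc'] := eqVneq c i.+1; last by rewrite hN.
  by subst c; have := lst i; lia.
exists q'; rewrite ?h1 ?hN // => y; have := h2 y; rewrite hN //.
Qed.

End Frank.

(** * Moving a column to the right end under a 312-avoiding bound *)

Section Lowering.
Variables n m : nat.

Definition push (M : mat) i x : mat := fun v c =>
  (M v c && ~~ ((v == x) && (c == i))) || ((v == x) && (c == i.+1)).

Lemma pushK (M : mat) i x : M x i -> ~~ M x i.+1 -> pull (push M i x) i x = M.
Proof.
move=> h0 h1; apply: matP => v c; rewrite pullE /push.
have [->|] := eqVneq v x; last by rewrite /= !andbT !orbF.
have [->|nc] := eqVneq c i; first by rewrite h0 orbT.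
have [->|nc'] := eqVneq c i.+1; first by rewrite (negbTE h1); lia.
by rewrite /= !andbT !orbF.
Qed.

(** The smallest unmatched value x of column i can be moved to the right. It is
    the last minimum of the difference of the two columns, and there is one
    unless that minimum is attained at the end. *)
Lemma push_ex M i y : supp n m M -> i.+1 < m ->
  colcnt M i y + colcnt M i.+1 n < colcnt M i n + colcnt M i.+1 y ->
  exists x, [/\ M x i, ~~ M x i.+1, x < n, raisable (push M i x) i x &
    (forall z, colcnt M i x + colcnt M i.+1 z <= colcnt M i z + colcnt M i.+1 x) /\
    (forall z, x < z -> colcnt M i x + colcnt M i.+1 z < colcnt M i z + colcnt M i.+1 x)].
Proof.
move=> h im hy.
have B z : colcnt M i.+1 z <= n by exact: colcnt_bound h.
have [x [z1 z2 z3]] := last_argmin (fun y => colcnt M i y + (n - colcnt M i.+1 y)) n.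
have z4 z : colcnt M i x + colcnt M i.+1 z <= colcnt M i z + colcnt M i.+1 x.
  case: (leqP z n) => hz; last rewrite !(colcnt_supp _ h (ltnW hz)).
    by have := z3 z hz; have := B z; have := B x; lia.
  by have := z3 n (leqnn _); have := B n; have := B x; lia.
have xn : x < n by rewrite ltn_neqAle z1 andbT; apply/eqP => e; have := z4 y; rewrite e; lia.
have z5 z : x < z -> colcnt M i x + colcnt M i.+1 z < colcnt M i z + colcnt M i.+1 x.
  move=> hz; case: (leqP z n) => hn; last rewrite !(colcnt_supp _ h (ltnW hn)).
    by have := z2 z; have := B z; have := B x; lia.
  by have := z2 n; have := B n; have := B x; lia.
have := z5 x.+1 (ltnSn x); rewrite !colcntS => h01.
have h0 : M x i by lia.
have h1 : ~~ M x i.+1 by lia.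
have p0 : ~~ push M i x x i by rewrite /push !eqxx andbF /=; lia.
have p1 : push M i x x i.+1 by rewrite /push !eqxx orbT.
have C c z := colcnt_pull c z p0 p1; rewrite pushK // in C.
exists x; split=> //.
have Ci z : colcnt M i z = colcnt (push M i x) i z + (x < z) by have := C i z; lia.
have Ci' z : colcnt M i.+1 z + (x < z) = colcnt (push M i x) i.+1 z by have := C i.+1 z; lia.
have s1 := colcntS M i x; have s2 := colcntS M i.+1 x; rewrite h0 (negbTE h1) in s1 s2.
by split=> z hz; have := z4 z; have := z5 z; have := Ci z; have := Ci x.+1;
   have := Ci' z; have := Ci' x.+1; lia.
Qed.

Lemma supp_push M i x : supp n m M -> i.+1 < m -> x < n -> supp n m (push M i x).
Proof. by move=> h im xn v c /orP[/andP[/h //]|/andP[/eqP-> /eqP->]]. Qed.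

Lemma colcnt_push (M : mat) i x y : M x i -> ~~ M x i.+1 ->
  colcnt M i y = colcnt (push M i x) i y + (x < y) /\
  colcnt (push M i x) i.+1 y = colcnt M i.+1 y + (x < y).
Proof.
move=> h0 h1.
have p0 : ~~ push M i x x i by rewrite /push !eqxx andbF /=; lia.
have p1 : push M i x x i.+1 by rewrite /push !eqxx orbT.
by have := colcnt_pull i y p0 p1; have := colcnt_pull i.+1 y p0 p1; rewrite pushK //; lia.
Qed.

(** For A = column i and B = column i + 1: the values of A from z on and those of
    B in [y, z) are together at most as many as the values of P from y on. For
    z = n this means B <= P entry by entry as soon as B is as long as P; the
    other z make the property stable when values move from A to B. *)
Definition fits (P : nat -> bool) M i := forall y z, y <= z ->
  colcnt M i n + colcnt M i.+1 z + cnt P y <= cnt P n + colcnt M i z + colcnt M i.+1 y.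

(** Moving x affects the inequality [fits] only for y <= x < z. There it follows
    from the inequality for y and x, because x is the last minimum of the
    difference of the columns. *)
Lemma lower_many P s M i y : supp n m M -> i.+1 < m ->
  colcnt M i y + colcnt M i.+1 n + s <= colcnt M i n + colcnt M i.+1 y -> fits P M i ->
  exists N,
  [/\ raises N M /\ supp n m N, forall v c, c != i -> c != i.+1 -> N v c = M v c,
      colcnt N i n + s = colcnt M i n, colcnt N i.+1 n = colcnt M i.+1 n + s
    & (forall y, colcnt M i.+1 y <= colcnt N i.+1 y) /\ fits P N i].
Proof.
elim: s M y => [|s IH] M y h im hy fP.
  by exists M; split; rewrite ?addn0 //; split=> //; exact: raises_refl.
have [|x [h0 h1 xn hx [z1 z2]]] := @push_ex M i y h im; first by lia.
have C z := colcnt_push z h0 h1.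
have s1 := colcntS M i x; have s2 := colcntS M i.+1 x; rewrite h0 (negbTE h1) in s1 s2.
have [||||N [[r sN] a1 a2 a3 [a4 a5]]] := IH (push M i x) x.+1.
- exact: supp_push.
- by [].
- by have := C n; have := C x.+1; have := z1 y; rewrite xn; lia.
- move=> u z uz; have := C n; have := C u; have := C z; rewrite xn.
  have := fP u z uz; have := fP u x; have := z2 z.
  by case: (ltnP x u); case: (ltnP x z); lia.
exists N; split=> //.
- split=> //; apply: raises_trans r _; apply: raises_step hx _.
  by rewrite pushK //; exact: raises_refl.
- by move=> v c c1 c2; rewrite a1 // /push (negbTE c1) (negbTE c2) !andbF orbF andbT.
- by have := C n; rewrite xn; lia.
- by have := C n; rewrite xn; lia.
by split=> // z; have := C z; have := a4 z; lia.
Qed.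

(** What 312-avoidance says about a prefix Q of a longer prefix P of a
    permutation: a value v that comes after P cannot have in P, in this order, a
    larger value inside Q and a smaller value outside Q. *)
Definition prefix_like (Q P : nat -> bool) :=
  (forall v, Q v -> P v) /\
  (forall v, ~~ P v -> (forall u, Q u -> u < v) \/ (forall u, u < v -> P u -> Q u)).

Lemma cnt_sub (Q P : nat -> bool) y z : (forall v, Q v -> P v) -> y <= z ->
  cnt Q z + cnt P y <= cnt P z + cnt Q y.
Proof.
move=> h /subnKC <-; elim: (z - y) => [|k IH]; first by rewrite addn0 addnC.
by rewrite addnS !cntS; have := h (y + k); lia.
Qed.

Lemma cnt_full (P : nat -> bool) y k : (forall v, y <= v < y + k -> P v) ->
  cnt P (y + k) = cnt P y + k.
Proof.
elim: k => [|k IH] h; first by rewrite !addn0.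
rewrite addnS cntS IH ?h; [lia|lia|move=> v hv; apply: h; lia].
Qed.

(** If P contains the whole interval [y, z), no set has more values there. Otherwise take v in [y, z) outside P. If Q lies below v, then all of Q
    above y lies in [y, v), where P has at least as many values. If Q contains
    the part of P below v, then P and Q agree below y, and it suffices to compare
    the two columns of M. *)
Lemma fits_prefix (P Q : nat -> bool) (M : mat) i : supp n m M -> prefix_like Q P ->
  (forall v, P v -> v < n) ->
  cnt P n = colcnt M i n -> cnt Q n = colcnt M i.+1 n ->
  (forall y, cnt P y <= colcnt M i y) -> (forall y, cnt Q y <= colcnt M i.+1 y) ->
  (forall y, colcnt M i.+1 y <= colcnt M i y) -> fits P M i.
Proof.
move=> s [QP h] Pn eP eQ lP lQ lM y z yz.
have Qn v : Q v -> v < n by move=> /QP /Pn.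
have [full|/existsNP[v /not_implyP[/andP[yv vz] /negP nPv]]] :=
  pselect (forall v, y <= v < z -> P v).
  have e : cnt P z = cnt P y + (z - y).
    have := @cnt_full P y (z - y); rewrite subnKC // => -> // v hv; apply: full; lia.
  by have := cnt_le (fun v => M v i.+1) yz; rewrite -/(colcnt _ _ _) -/(colcnt _ _ _);
     have := lP z; lia.
case: (h v nPv) => hv.
  have e : cnt Q v = cnt Q n.
    by case: (leqP n v) => nv; [exact: cnt_stable|
       symmetry; apply: cnt_stable => //; lia].
  have := cnt_sub QP yv; have := cnt_mono P (ltnW vz).
  have : colcnt M i.+1 z <= colcnt M i.+1 n.
    by case: (leqP z n) => zn; [exact: cnt_mono|rewrite (colcnt_supp _ s (ltnW zn))].
  by have := lQ y; have := lP z; lia.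
have e : cnt P y = cnt Q y.
  apply: eq_cnt => u uy; apply/idP/idP; [apply: hv; lia|exact: QP].
by have := lQ y; have := lM z; lia.
Qed.

(** The column that starts as column j of T is exchanged with the columns to its
    right, one after the other. It keeps containing the column it has just
    replaced, whence the last clause, which keeps the next exchange possible. *)
Lemma lower_chain (T : mat) (j : nat) (P : nat -> bool) (Q : nat -> nat -> bool) :
  supp n m T -> straight T -> j < m -> (forall v, P v -> v < n) ->
  cnt P n = colcnt T j n -> (forall y, cnt P y <= colcnt T j y) ->
  (forall p, j < p -> p < m -> [/\ prefix_like (Q p) P, cnt (Q p) n = colcnt T p n &
     forall y, cnt (Q p) y <= colcnt T p y]) ->
  forall p, j <= p -> p < m -> exists M,
   [/\ raises M T /\ supp n m M,
       forall c, colcnt M c n = colcnt T (if c < j then c else if c < p then c.+1 else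
                                  if c == p then j else c) n,
       forall v c, p < c -> M v c = T v c,
       forall y, cnt P y <= colcnt M p y & forall y, colcnt T p.+1 y <= colcnt M p y].
Proof.
move=> s sT jm Pn eP lP hQ p jp.
rewrite -(subnKC jp); elim: (p - j) => [|k IH] pm.
  rewrite addn0; exists T; split=> //; first by split=> //; exact: raises_refl.
  by move=> c; case: (ltngtP c j) => // ->.
have [|M [[r sM] hM eM lM dM]] := IH; first by lia.
rewrite addnS; set q := j + k in r hM eM lM dM *.
have qm : q.+1 < m by rewrite /q -addnS.
have [||preQ eQ lQ] := hQ q.+1; [lia|lia|].
have eM1 y : colcnt M q.+1 y = colcnt T q.+1 y by apply: eq_cnt => v _; exact: eM.
have hMq : colcnt M q n = colcnt T j n.
  by rewrite hM /q (_ : (j + k < j) = false) ?ltnn ?eqxx //; lia.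
have fP : fits P M q.
  apply: (fits_prefix sM preQ); rewrite ?hMq ?eM1 //.
    by move=> y; rewrite eM1.
  by move=> y; rewrite eM1.
have hle : colcnt T q.+1 n <= colcnt T j n by rewrite -hMq.
have [|N [[rN sN] a1 a2 a3 [a4 a5]]] :=
  @lower_many P (colcnt T j n - colcnt T q.+1 n) M q 0 sM qm _ fP.
  by rewrite !colcnt0 hMq eM1; lia.
have hN c y : c != q -> c != q.+1 -> colcnt N c y = colcnt M c y.
  by move=> c1 c2; apply: eq_cnt => v _; exact: a1.
have eN1 : colcnt N q.+1 n = colcnt T j n by rewrite a3 eM1; lia.
exists N; split.
- by split=> //; exact: raises_trans r.
- move=> c; have [e|nc] := eqVneq c q.
    rewrite e (_ : (q < j) = false) ?ltnSn; last by lia.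
    by move: a2; rewrite hMq; lia.
  have [e|nc'] := eqVneq c q.+1.
    by rewrite e eN1 (_ : (q.+1 < j) = false) ?ltnn ?eqxx //; lia.
  rewrite hN // hM (negbTE nc); congr (colcnt T _ n); case: (ltnP c j) => // _.
  by rewrite (_ : (c < q.+1) = (c < q)) //; lia.
- by move=> v c hc; rewrite a1 ?eM //; lia.
- move=> y; have [yn|ny] := leqP y n; last first.
    by rewrite (colcnt_supp _ sN (ltnW ny)) (cnt_stable Pn (ltnW ny)) eP eN1.
  by have := a5 y n yn; rewrite eN1; have := a2; rewrite hMq; lia.
- by move=> y; apply: leq_trans (a4 y); rewrite eM1; exact: sT.
Qed.

End Lowering.

(** * Slides as raising operators *)

Lemma cnt_iota (A : nat -> bool) a k : cnt A (a + k) = cnt A a + size (filter A (iota a k)).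
Proof.
elim: k => [|k IH]; first by rewrite !addn0.
by rewrite addnS cntS IH -addn1 iotaD filter_cat size_cat /= -addnA; case: (A _).
Qed.

Lemma cnt_inj (A B : nat -> bool) (R : nat -> nat -> Prop) a b : a <= b ->
  (forall v, a <= v < b -> A v -> exists u, [/\ a <= u < b, B u & R v u]) ->
  (forall v v' u, R v u -> R v' u -> v = v') ->
  cnt A b + cnt B a <= cnt B b + cnt A a.
Proof.
move=> ab h inj; rewrite -(subnKC ab) !cnt_iota; set k := b - a.
suff : size (filter A (iota a k)) <= size (filter B (iota a k)) by lia.
have /choice[f hf] : forall v, exists u, a <= v < b -> A v -> [/\ a <= u < b, B u & R v u].
  move=> v; have [[h1 h2]|hn] := pselect (a <= v < b /\ A v).
    by have [u hu] := h v h1 h2; exists u.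
  by exists 0 => ? ?; case: hn.
have mi v : (v \in iota a k) = (a <= v < b) by rewrite mem_iota /k subnKC.
rewrite -(size_map f); apply: uniq_leq_size.
  rewrite map_inj_in_uniq ?filter_uniq ?iota_uniq // => v v'.
  rewrite !mem_filter !mi => /andP[Av rv] /andP[Av' rv'] e.
  have [_ _ R1] := hf _ rv Av; have [_ _ R2] := hf _ rv' Av'.
  by apply: inj R1 _; rewrite e.
move=> u /mapP[v]; rewrite mem_filter mi => /andP[Av rv] ->.
by have [? ? _] := hf _ rv Av; rewrite mem_filter mi; apply/andP.
Qed.

Section Slides.
Variable n : nat.
Implicit Types (F : filling n) (Dm Dn : pred box).

Definition mat_of F : mat := fun v c =>
  `[< exists r (u : 'I_n), F (c, r) = Some u /\ u = v :> nat >].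

Lemma mat_ofP F v c :
  reflect (exists r (u : 'I_n), F (c, r) = Some u /\ u = v :> nat) (mat_of F v c).
Proof. exact: asboolP. Qed.

Definition ideal (D : pred box) :=
  forall c c' r r', c' <= c -> r' <= r -> D (c, r) -> D (c', r').

Definition rows_ok F := forall (j j' i : nat) (x y : 'I_n),
  j < j' -> F (j, i) = Some x -> F (j', i) = Some y -> x <= y.
Definition cols_ok F := forall (j i i' : nat) (x y : 'I_n),
  i < i' -> F (j, i) = Some x -> F (j, i') = Some y -> x < y.

(** A skew tableau whose inner and outer shapes are arbitrary order ideals. These
    are sets of boxes, not sequences, because a slide yields its outer shape as
    the old one without a box. *)
Definition skewed Dm Dn F :=
  [/\ ideal Dm, ideal Dn, forall b, Dm b -> Dn b,
      forall b, isSome (F b) = Dn b && ~~ Dm b & rows_ok F /\ cols_ok F].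

(** A skew tableau in the course of a slide, with its hole at b; the box b has
    already been taken away from the inner shape and not yet from the outer
    one. *)
Definition holed Dm Dn F b :=
  [/\ ideal Dm, ideal Dn, (forall b, Dm b -> Dn b) /\ (Dn b && ~~ Dm b),
      forall b', isSome (F b') = [&& Dn b', ~~ Dm b' & b' != b] & rows_ok F /\ cols_ok F].

Lemma dom_ex F b (P : bool) : isSome (F b) = P -> P -> exists u, F b = Some u.
Proof. by case: (F b) => [u|<-] // _ _; exists u. Qed.

Lemma some_dom F b (P : bool) u : isSome (F b) = P -> F b = Some u -> P.
Proof. by move=> <- ->. Qed.

Lemma hole_below Dm Dn F j r (y : 'I_n) : holed Dm Dn F (j, r) -> F (j, r.+1) = Some y ->
  (forall x : 'I_n, F (j.+1, r) = Some x -> y <= x) ->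
  holed Dm Dn (move_entry F (j, r.+1) (j, r)) (j, r.+1) /\
  mat_of (move_entry F (j, r.+1) (j, r)) = mat_of F.
Proof.
move=> [Im In [sub /andP[nb mb]] dom [ro co]] hy hx.
have /and3P[ny my _] := some_dom (dom _) hy.
have brr : (j, r.+1) == (j, r) = false by rewrite xpair_eqE; lia.
have Fb : F (j, r) = None by move: (dom (j, r)); rewrite eqxx !andbF; case: (F _).
split.
  split=> //; first by rewrite ny my.
    move=> b'; rewrite /move_entry; case: eqP => [->|/eqP nb'].
      by rewrite hy nb mb eq_sym brr.
    by case: eqP => [->|_]; rewrite ?andbF // dom nb'.
  split.
    move=> c c' i u v ltcc; rewrite /move_entry.
    have [[e1 e2]|] := eqVneq (c, i) (j, r).
      subst c i; rewrite hy => -[<-]; rewrite xpair_eqE eqxx andbT.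
      have [|_] := eqVneq c' j; first lia.
      rewrite xpair_eqE andbC; have -> : (r == r.+1) = false by lia.
      rewrite /= => hv; have /and3P[nv mv _] := some_dom (dom _) hv.
      have [|x ex] := @dom_ex F (j.+1, r) _ (dom _).
        rewrite (In _ _ _ _ _ _ nv) ?xpair_eqE //=.
        apply/andP; split; last by lia.
        by apply: contra mb; apply: Im.
      apply: leq_trans (hx _ ex) _.
      have [e|ne] := eqVneq c' j.+1; first by move: hv; rewrite e ex => -[->].
      by apply: ro ex hv; lia.
    move=> n1; have [//|n2] := eqVneq (c, i) (j, r.+1) => hu.
    have [[e1 e2]|n3] := eqVneq (c', i) (j, r).
      rewrite hy => -[<-]; subst c' i; have /and3P[nu mu _] := some_dom (dom _) hu.
      have [|z ez] := @dom_ex F (c, r.+1) _ (dom _).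
        rewrite (In _ _ _ _ _ _ ny) ?xpair_eqE //=; last by lia.
        apply/andP; split; last by lia.
        by apply: contra mu; apply: Im.
      by have := co _ _ _ _ _ (ltnSn r) hu ez; have := ro _ _ _ _ _ ltcc ez hy; lia.
    by have [//|n4] := eqVneq (c', i) (j, r.+1) => hv; exact: ro hu hv.
  move=> c i i' u v ii'; rewrite /move_entry.
  have [[e1 e2]|] := eqVneq (c, i) (j, r).
    subst c i; rewrite hy => -[<-]; have [[]|_] := eqVneq (j, i') (j, r); first lia.
    have [//|nn] := eqVneq (j, i') (j, r.+1) => hv; apply: co hy hv.
    by move: nn; rewrite xpair_eqE eqxx; lia.
  move=> n1; have [//|n2] := eqVneq (c, i) (j, r.+1) => hu.
  have [[e1 e2]|n3] := eqVneq (c, i') (j, r).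
    by rewrite hy => -[<-]; subst c i'; apply: co hu hy; lia.
  by have [//|n4] := eqVneq (c, i') (j, r.+1) => hv; exact: co hu hv.
apply: matP => v c; apply/mat_ofP/mat_ofP => -[i [u [hu hv]]].
  move: hu; rewrite /move_entry; have [[-> _]|_] := eqVneq (c, i) (j, r).
    by move=> hu; exists r.+1, u.
  by have [//|_] := eqVneq (c, i) (j, r.+1) => hu; exists i, u.
have [[e1 e2]|n1] := eqVneq (c, i) (j, r.+1).
  by subst c i; exists r, u; rewrite /move_entry eqxx.
exists i, u; split=> //; rewrite /move_entry (negbTE n1).
by have [e|//] := eqVneq (c, i) (j, r); move: hu; rewrite e Fb.
Qed.

(** When the hole at row r of column j moves right, the entry x crossing over is
    the largest unmatched one. Below row r each entry of column j + 1 has an entry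
    of column j to its left, which is at most as large and exceeds x. Above row r
    each entry of column j has a right neighbour, which is at least as large and
    smaller than x. *)
Lemma hole_right Dm Dn F j r (x : 'I_n) : holed Dm Dn F (j, r) -> F (j.+1, r) = Some x ->
  (forall y : 'I_n, F (j, r.+1) = Some y -> x < y) ->
  [/\ holed Dm Dn (move_entry F (j.+1, r) (j, r)) (j.+1, r),
      raisable (mat_of F) j x &
      mat_of (move_entry F (j.+1, r) (j, r)) = pull (mat_of F) j x].
Proof.
move=> [Im In [sub /andP[nb mb]] dom [ro co]] hx hy.
have /and3P[nx mx _] := some_dom (dom _) hx.
have brr : (j.+1, r) == (j, r) = false by rewrite xpair_eqE; lia.
have Fb : F (j, r) = None by move: (dom (j, r)); rewrite eqxx !andbF; case: (F _).
(* under and left show that every entry of column j + 1 larger than x is matched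
   by a smaller entry of column j; above shows that x itself is unmatched *)
have under i u : r < i -> F (j, i) = Some u -> x < u.
  move=> ri hu; have /and3P[nu mu _] := some_dom (dom _) hu.
  have [|z ez] := @dom_ex F (j, r.+1) _ (dom _).
    rewrite (In _ _ _ _ _ _ nu) ?xpair_eqE //=; apply/andP; split; last by lia.
    by apply: contra mb; apply: Im.
  have := hy _ ez; have [e|ne] := eqVneq i r.+1; first by move: hu; rewrite e ez => -[->].
  by have := co _ _ _ _ _ _ ez hu; lia.
have above i u : i < r -> F (j, i) = Some u ->
    exists z : 'I_n, [/\ F (j.+1, i) = Some z, u <= z & z < x].
  move=> ir hu; have /and3P[nu mu _] := some_dom (dom _) hu.
  have [|z ez] := @dom_ex F (j.+1, i) _ (dom _).
    rewrite (In _ _ _ _ _ _ nx) ?xpair_eqE //=; last by lia.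
    by apply/andP; split; [apply: contra mu; apply: Im|lia].
  by exists z; split=> //; [apply: ro hu ez|apply: co ez hx].
have left i u : r < i -> F (j.+1, i) = Some u ->
    exists z : 'I_n, [/\ F (j, i) = Some z, z <= u & x < z].
  move=> ri hu; have /and3P[nu mu _] := some_dom (dom _) hu.
  have [|z ez] := @dom_ex F (j, i) _ (dom _).
    rewrite (In _ _ _ _ _ _ nu) ?xpair_eqE //=.
    by apply/andP; split; [apply: contra mb; apply: Im; lia|lia].
  by exists z; split=> //; [apply: ro ez hu|apply: under ez].
split.
- split=> //; first by rewrite nx mx.
    move=> b'; rewrite /move_entry; case: eqP => [->|/eqP nb'].
      by rewrite hx nb mb eq_sym brr.
    by case: eqP => [->|_]; rewrite ?andbF // dom nb'.
  split.
    move=> c c' i u v ltcc; rewrite /move_entry.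
    have [[e1 e2]|] := eqVneq (c, i) (j, r).
      subst c i; rewrite hx => -[<-]; have [[]|_] := eqVneq (c', r) (j, r); first lia.
      have [//|nn] := eqVneq (c', r) (j.+1, r) => hv; apply: ro hx hv.
      by move: nn; rewrite xpair_eqE eqxx; lia.
    move=> n1; have [//|n2] := eqVneq (c, i) (j.+1, r) => hu.
    have [[e1 e2]|n3] := eqVneq (c', i) (j, r).
      by rewrite hx => -[<-]; subst c' i; apply: ro hu hx; lia.
    by have [//|n4] := eqVneq (c', i) (j.+1, r) => hv; exact: ro hu hv.
  move=> c i i' u v ii'; rewrite /move_entry.
  have [[e1 e2]|] := eqVneq (c, i) (j, r).
    rewrite hx => -[<-]; subst c i; have [[]|_] := eqVneq (j, i') (j, r); first lia.
    by have [//|nn] := eqVneq (j, i') (j.+1, r) => hv; exact: under hv.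
  move=> n1; have [//|n2] := eqVneq (c, i) (j.+1, r) => hu.
  have [[e1 e2]|n3] := eqVneq (c, i') (j, r).
    by rewrite hx => -[<-]; subst c i'; have [z [_ ? ?]] := above _ _ ii' hu; lia.
  by have [//|n4] := eqVneq (c, i') (j.+1, r) => hv; exact: co hu hv.
- have Mx : mat_of F x j.+1 by apply/mat_ofP; exists r, x.
  have Mx0 : ~~ mat_of F x j.
    apply/negP => /mat_ofP[i [u [hu e]]]; case: (ltngtP i r) => ir.
    + by have [z [_ ? ?]] := above _ _ ir hu; lia.
    + by have := under _ _ ir hu; lia.
    + by move: hu; rewrite ir Fb.
  pose R1 v u := exists i (v' u' : 'I_n),
    [/\ F (j, i) = Some v', F (j.+1, i) = Some u', v' = v :> nat & u' = u :> nat].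
  have inj1 v v' u : R1 v u -> R1 v' u -> v = v'.
    move=> [i [a [a' [h1 h2 e1 e2]]]] [k [b [b' [h3 h4 e3 e4]]]].
    case: (ltngtP i k) => ik.
    + by have := co _ _ _ _ _ ik h2 h4; lia.
    + by have := co _ _ _ _ _ ik h4 h2; lia.
    + by move: h3; rewrite -ik h1 -e1 -e3 => -[->].
  have inj2 v v' u : R1 u v -> R1 u v' -> v = v'.
    move=> [i [a [a' [h1 h2 e1 e2]]]] [k [b [b' [h3 h4 e3 e4]]]].
    case: (ltngtP i k) => ik.
    + by have := co _ _ _ _ _ ik h1 h3; lia.
    + by have := co _ _ _ _ _ ik h3 h1; lia.
    + by move: h4; rewrite -ik h2 -e2 -e4 => -[->].
  split=> y hyx.
    have := @cnt_inj (fun v => mat_of F v j) (fun v => mat_of F v j.+1) R1 y x hyx.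
    rewrite -/(colcnt _ _ _) !colcntS Mx (negbTE Mx0) => /(_ _ inj1) h.
    suff : colcnt (mat_of F) j x + colcnt (mat_of F) j.+1 y <=
           colcnt (mat_of F) j.+1 x + colcnt (mat_of F) j y by lia.
    apply: h => v /andP[yv vx] /mat_ofP[i [u [hu e]]]; case: (ltngtP i r) => ir.
    + have [z [hz uz zx]] := above _ _ ir hu; exists z; split; first lia.
        by apply/mat_ofP; exists i, z.
      by exists i, u, z.
    + by have := under _ _ ir hu; lia.
    + by move: hu; rewrite ir Fb.
  have := @cnt_inj (fun v => mat_of F v j.+1) (fun v => mat_of F v j)
    (fun v u => R1 u v) x.+1 y hyx.
  move=> /(_ _ (fun v v' u => @inj2 v v' u)) h.
  rewrite addnC [X in _ <= X]addnC [X in _ <= X]addnC; apply: h.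
  move=> v /andP[xv vy] /mat_ofP[i [u [hu e]]]; case: (ltngtP i r) => ir.
  + by have := co _ _ _ _ _ ir hu hx; lia.
  + have [z [hz uz zx]] := left _ _ ir hu; exists z; split; first lia.
      by apply/mat_ofP; exists i, z.
    by exists i, z, u.
  + by move: hu; rewrite ir hx => -[e']; rewrite -e -e' ltnn in xv.
apply: matP => v c; rewrite pullE; apply/mat_ofP/idP => [[i [u []]]|].
  rewrite /move_entry; have [[-> _]|n1] := eqVneq (c, i) (j, r).
    by rewrite hx => -[<-] <-; rewrite !eqxx orbT.
  have [//|n2] := eqVneq (c, i) (j.+1, r) => hu e.
  apply/orP; left; apply/andP; split; first by apply/mat_ofP; exists i, u.
  apply/negP => /andP[/eqP e1 /eqP e2]; subst c.
  case: (ltngtP i r) => ir.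
  + by have := co _ _ _ _ _ ir hu hx; lia.
  + by have := co _ _ _ _ _ ir hx hu; lia.
  + by rewrite ir eqxx in n2.
case/orP => [/andP[/mat_ofP[i [u [hu e]]] nxc]|/andP[/eqP-> /eqP->]]; last first.
  by exists r, x; rewrite /move_entry eqxx.
exists i, u; split=> //; rewrite /move_entry.
have [e1|n1] := eqVneq (c, i) (j, r); first by move: hu; rewrite e1 Fb.
have [[e1 e2]|//] := eqVneq (c, i) (j.+1, r).
by move: nxc hu; rewrite e1 e2 hx => /negP nxc [e3]; case: nxc; rewrite -e e3 !eqxx.
Qed.

Lemma hole_stop Dm Dn F j r : holed Dm Dn F (j, r) ->
  F (j.+1, r) = None -> F (j, r.+1) = None ->
  skewed Dm (fun b => Dn b && (b != (j, r))) F.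
Proof.
move=> [Im In [sub /andP[nb mb]] dom [ro co]] hr hb.
have nr : ~~ Dn (j.+1, r).
  apply/negP => h; have := dom (j.+1, r); rewrite hr h xpair_eqE /=.
  have -> : ~~ Dm (j.+1, r) by apply: contra mb; apply: Im.
  lia.
have nb' : ~~ Dn (j, r.+1).
  apply/negP => h; have := dom (j, r.+1); rewrite hb h xpair_eqE /=.
  have -> : ~~ Dm (j, r.+1) by apply: contra mb; apply: Im.
  lia.
split=> //.
- move=> c c' i i' h1 h2 /andP[h3 h4]; rewrite (In _ _ _ _ h1 h2 h3) /= xpair_eqE.
  apply/negP => /andP[/eqP e1 /eqP e2]; subst c' i'.
  move: h4; rewrite xpair_eqE; have [e|nc] := eqVneq c j => /= h4.
    by move/negP: nb'; apply; apply: In h3; lia.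
  by move/negP: nr; apply; apply: In h3; lia.
- by move=> b hb1; rewrite sub //=; apply/eqP => e; move: mb; rewrite -e hb1.
- by move=> b; rewrite dom -!andbA; congr andb; rewrite andbC.
Qed.

(** Downward moves of the hole do not change which values occur in a column. *)
Lemma slide_skewed Dm Dn F b F' : slide F b F' -> holed Dm Dn F b ->
  raises (mat_of F) (mat_of F') /\
  exists2 Dn', skewed Dm Dn' F' & forall b, Dn' b -> Dn b.
Proof.
elim=> {F b F'} [F [j r] h1 h2 h|F [j r] x F' h1 h2 _ IH h|F [j r] x F' h1 h2 _ IH h].
- split; first exact: raises_refl.
  by exists (fun b => Dn b && (b != (j, r))); [exact: hole_stop|move=> b /andP[]].
- have [A B C] := hole_right h h1 h2; have [r1 ?] := IH A; split=> //.
  by apply: raises_step B _; rewrite -C.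
- by have [A B] := hole_below h h1 h2; have [r1 ?] := IH A; split=> //; rewrite -B.
Qed.

Definition bounded N Dn := forall b, Dn b -> b.1 < N /\ b.2 < N.

Lemma slide_ex Dm Dn F b N : bounded N Dn -> holed Dm Dn F b -> exists F', slide F b F'.
Proof.
move=> bd; move: {2}(N + N - (b.1 + b.2)) (leqnn (N + N - (b.1 + b.2))) => k.
elim: k F b => [|k IH] F [j r] /= hk h;
  have [_ _ [_ /andP[/bd/= [b1 b2] _]] _ _] := h; first by lia.
case hb : (F (j, r.+1)) => [y|]; case hr : (F (j.+1, r)) => [x|].
- have [xy|yx] := ltnP x y.
    have hy : forall y' : 'I_n, F (j, r.+1) = Some y' -> x < y'.
      by move=> y'; rewrite hb => -[<-].
    have [A _ _] := hole_right h hr hy; have [|F' sF] := IH _ _ _ A; first by move=> /=; lia.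
    by exists F'; exact: (@slide_right n F (j, r) x F' hr hy sF).
  have hx : forall x' : 'I_n, F (j.+1, r) = Some x' -> y <= x'.
    by move=> x'; rewrite hr => -[<-].
  have [A _] := hole_below h hb hx; have [|F' sF] := IH _ _ _ A; first by move=> /=; lia.
  by exists F'; exact: (@slide_below n F (j, r) y F' hb hx sF).
- have hx : forall x' : 'I_n, F (j.+1, r) = Some x' -> y <= x' by move=> x'; rewrite hr.
  have [A _] := hole_below h hb hx; have [|F' sF] := IH _ _ _ A; first by move=> /=; lia.
  by exists F'; exact: (@slide_below n F (j, r) y F' hb hx sF).
- have hy : forall y' : 'I_n, F (j, r.+1) = Some y' -> x < y' by move=> y'; rewrite hb.
  have [A _ _] := hole_right h hr hy; have [|F' sF] := IH _ _ _ A; first by move=> /=; lia.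
  by exists F'; exact: (@slide_right n F (j, r) x F' hr hy sF).
by exists F; exact: slide_stop.
Qed.

Lemma in_diagram_ideal mu : is_partition mu -> ideal (in_diagram mu).
Proof.
move=> /(sorted_leq_nth (fun a b c h1 h2 => leq_trans h2 h1) leqnn 0) h c c' r r' hc hr.
rewrite /in_diagram /= => lt.
have rs : r < size mu by rewrite ltnNge; apply/negP => sr; move: lt; rewrite nth_default.
by have := h r' r; rewrite !inE rs => /(_ (leq_ltn_trans hr rs) isT hr) /=; lia.
Qed.

Lemma partition_nth mu : (forall i, nth 0 mu i.+1 <= nth 0 mu i) -> is_partition mu.
Proof. by move=> h; apply/(sortedP 0) => i _; exact: h. Qed.

Lemma in_remove_corner mu b b' : is_partition mu -> inside_corner mu b ->
  in_diagram (remove_corner mu b) b' = in_diagram mu b' && (b' != b).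
Proof.
case: b b' => [c r] [c' r'] pm /and3P[h1 h2 _].
rewrite /in_diagram /remove_corner nth_set_nth /= xpair_eqE.
by move: h1 h2; rewrite /in_diagram /=; have [->|_] := eqVneq r' r; lia.
Qed.

Lemma remove_corner_partition mu b : is_partition mu -> inside_corner mu b ->
  is_partition (remove_corner mu b).
Proof.
move=> pm ic; apply: partition_nth => i; rewrite leqNgt; apply/negP => lt.
have I := in_diagram_ideal pm.
set c := nth 0 (remove_corner mu b) i in lt.
have : in_diagram (remove_corner mu b) (c, i.+1) by [].
rewrite in_remove_corner // => /andP[h1 h2].
have : ~~ in_diagram (remove_corner mu b) (c, i) by rewrite /in_diagram /= -/c ltnn.
rewrite in_remove_corner // (I _ _ _ _ (leqnn _) (leqnSn i) h1) /= negbK => /eqP e.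
by case/and3P: ic => _ _; rewrite -e /below /= h1.
Qed.

Lemma corner_ex mu c r : in_diagram mu (c, r) -> exists b, inside_corner mu b.
Proof.
set N := \sum_(i < size mu) nth 0 mu i.
have bd c' r' : in_diagram mu (c', r') -> c' < N /\ r' < size mu.
  rewrite /in_diagram /= => lt.
  have rs : r' < size mu by rewrite ltnNge; apply/negP => sr; move: lt; rewrite nth_default.
  by split=> //; rewrite /N (bigD1 (Ordinal rs)) //=; lia.
move: {2}(N + size mu - (c + r)) (leqnn (N + size mu - (c + r))) => k.
elim: k c r => [|k IH] c r hk h; have [h1 h2] := bd _ _ h; first by lia.
have [hr|nr] := boolP (in_diagram mu (c.+1, r)); first by apply: IH hr; lia.
have [hb|nb] := boolP (in_diagram mu (c, r.+1)); first by apply: IH hb; lia.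
by exists (c, r); rewrite /inside_corner h nr nb.
Qed.

Lemma skewed_ext Dm Dm' Dn F : Dm =1 Dm' -> skewed Dm Dn F -> skewed Dm' Dn F.
Proof.
move=> e [Im In sub dom sst]; split=> //.
- by move=> c c' r r' h1 h2; rewrite -!e; exact: Im.
- by move=> b; rewrite -e; exact: sub.
- by move=> b; rewrite -e.
Qed.

Lemma corner_holed mu Dn F b : is_partition mu -> inside_corner mu b ->
  skewed (in_diagram mu) Dn F -> holed (in_diagram (remove_corner mu b)) Dn F b.
Proof.
move=> pm ic [Im In sub dom sst]; split=> //.
- exact: in_diagram_ideal (remove_corner_partition pm ic).
- split; first by move=> b'; rewrite in_remove_corner // => /andP[/sub].
  by rewrite in_remove_corner // eqxx andbF sub //; case/and3P: ic.
- move=> b'; rewrite dom in_remove_corner //.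
  by have [->|_] := eqVneq b' b; rewrite ?andbT // andbF; case/and3P: ic => ->; rewrite andbF.
Qed.

Lemma rectifies_raises mu S T Dn : rectifies mu S T -> is_partition mu ->
  skewed (in_diagram mu) Dn S ->
  raises (mat_of S) (mat_of T) /\
  exists2 Dn', skewed pred0 Dn' T & forall b, Dn' b -> Dn b.
Proof.
move=> h; elim: h Dn => {mu S T} [mu S nc Dn pm sk|mu S b S' T ic sl _ IH Dn pm sk].
  split; first exact: raises_refl.
  exists Dn => //; apply: skewed_ext sk => -[c r]; apply/negP => /corner_ex[b].
  by rewrite (negbTE (nc b)).
have [r1 [Dn' sk' sub]] := slide_skewed sl (corner_holed pm ic sk).
have [r2 [Dn'' sk'' sub']] := IH _ (remove_corner_partition pm ic) sk'.
split; first exact: raises_trans r1 r2.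
by exists Dn'' => // b' /sub' /sub.
Qed.

(** Existence of a rectification; that a particular tableau is reached then
    follows from uniqueness, without performing the slides. *)
Lemma rectifies_ex mu S Dn N : bounded N Dn -> is_partition mu ->
  skewed (in_diagram mu) Dn S -> exists T, rectifies mu S T.
Proof.
move: {2}(sumn mu) (leqnn (sumn mu)) => k; elim: k mu S Dn => [|k IH] mu S Dn hk bd pm sk;
  have [[b ic]|/forallNP nc] := pselect (exists b, inside_corner mu b);
  try by exists S; apply: rectifies_done => b; apply/negP; exact: nc.
  case/and3P: ic; rewrite /in_diagram => h _ _; move: hk.
  have hs : b.2 < size mu by rewrite ltnNge; apply/negP => sr; move: h; rewrite nth_default.
  by rewrite sumnE (big_nth 0) big_mkord (bigD1 (Ordinal hs)) //=; lia.
have hl : sumn (remove_corner mu b) <= k.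
  case/and3P: ic; rewrite /in_diagram => h _ _; move: hk.
  by rewrite /remove_corner sumn_set_nth0; lia.
have [S' sl] := slide_ex bd (corner_holed pm ic sk).
have [_ [Dn' sk' sub]] := slide_skewed sl (corner_holed pm ic sk).
have [|T rT] := IH _ _ _ hl _ (remove_corner_partition pm ic) sk'.
  by move=> b' /sub /bd.
by exists T; exact: rectifies_slide rT.
Qed.

Lemma skewed_straight Dn T : skewed pred0 Dn T -> straight (mat_of T).
Proof.
move=> [_ In _ dom [ro co]] i y.
pose R (v u : nat) := exists r (v' u' : 'I_n),
    [/\ T (i.+1, r) = Some v', T (i, r) = Some u', v' = v :> nat & u' = u :> nat].
have := @cnt_inj (fun v => mat_of T v i.+1) (fun v => mat_of T v i) R 0 y (leq0n _).
rewrite !cnt0 !addn0; apply.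
  move=> v hv /mat_ofP[r [u [hu e]]].
  have := dom (i.+1, r); rewrite hu /= andbT => /esym d.
  have [|z hz] := @dom_ex T (i, r) _ (dom _).
    by rewrite andbT; apply: In d.
  have zu := ro _ _ _ _ _ (ltnSn i) hz hu.
  by exists z; split; [lia|apply/mat_ofP; exists r, z|exists r, u, z].
move=> v v' u [r [a [a' [h1 h2 e1 e2]]]] [k [b [b' [h3 h4 e3 e4]]]].
case: (ltngtP r k) => ik.
+ by have := co _ _ _ _ _ ik h2 h4; lia.
+ by have := co _ _ _ _ _ ik h4 h2; lia.
+ by move: h3; rewrite -ik h1 -e1 -e3 => -[->].
Qed.

Lemma mat_of_supp Dm Dn F N : skewed Dm Dn F ->
  (forall b, Dn b -> b.1 < N) -> supp n N (mat_of F).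
Proof.
move=> [_ _ _ dom _] bd v c /mat_ofP[r [u [hu <-]]]; split=> //.
by have := dom (c, r); rewrite hu => /esym/andP[/bd].
Qed.
End Slides.

(** * Columns as increasing lists *)

Section Columns.
Variable n : nat.
Implicit Types (f g : nat -> option 'I_n) (p : nat -> bool) (F : filling n).

Definition ltI : rel 'I_n := fun u v => u < v.
Lemma ltI_trans : transitive ltI. Proof. by move=> u v w; exact: ltn_trans. Qed.
Lemma ltI_irr : irreflexive ltI. Proof. by move=> u; exact: ltnn. Qed.

Definition list_of p : seq 'I_n := [seq u : 'I_n <- enum 'I_n | p u].

Lemma mem_list_of p (u : 'I_n) : (u \in list_of p) = p u.
Proof. by rewrite mem_filter mem_enum andbT. Qed.

Lemma list_of_sorted p : sorted ltI (list_of p).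
Proof.
apply: sorted_filter; first exact: ltI_trans.
have := iota_ltn_sorted 0 n; rewrite -val_enum_ord sorted_map; exact.
Qed.

Lemma sorted_list_of s p : sorted ltI s -> (forall u, (u \in s) = p u) -> s = list_of p.
Proof.
move=> h e; apply: (irr_sorted_eq ltI_trans ltI_irr h (list_of_sorted p)) => u.
by rewrite e mem_list_of.
Qed.

Lemma size_list_of p : size (list_of p) = cnt p n.
Proof.
by have := cnt_iota p 0 n; rewrite cnt0 !add0n => ->; rewrite -val_enum_ord filter_map size_map.
Qed.

Definition increasing f := forall i i' (x y : 'I_n),
  i < i' -> f i = Some x -> f i' = Some y -> x < y.

Definition entries f : nat -> bool := fun v =>
  `[< exists r (u : 'I_n), f r = Some u /\ u = v :> nat >].

Lemma entriesP f v : reflect (exists r (u : 'I_n), f r = Some u /\ u = v :> nat) (entries f v).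
Proof. exact: asboolP. Qed.

Lemma entries_ord f (u : 'I_n) : reflect (exists r, f r = Some u) (entries f u).
Proof.
apply: (iffP (entriesP f u)) => [[r [v [hv /val_inj e]]]|[r hr]]; first by exists r; rewrite -e.
by exists r, u.
Qed.

Lemma entries_lt f v : entries f v -> v < n.
Proof. by move=> /entriesP[r [u [_ <-]]]. Qed.

Lemma pmap_list_of f N : increasing f -> (forall r, f r -> r < N) ->
  pmap f (iota 0 N) = list_of (entries f).
Proof.
move=> inc bd; apply: sorted_list_of => [|u].
  rewrite (sorted_pairwise ltI_trans).
  have : pairwise ltn (iota 0 N) by rewrite -(sorted_pairwise ltn_trans) iota_ltn_sorted.
  elim: (iota 0 N) => //= r s IH /andP[/allP hr /IH hs]; case E: (f r) => [u|] //=.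
  rewrite hs andbT; apply/allP => v; rewrite mem_pmap => /mapP[r' hr' e].
  by apply: (inc r r'); [exact: hr| |].
rewrite mem_pmap; apply/mapP/entries_ord => [[r _ e]|[r e]]; first by exists r.
by exists r => //; rewrite mem_iota /= add0n bd // e.
Qed.

(** A column of a straight tableau, occupying the rows 0, ..., k - 1. *)
Definition column f k := (forall r, isSome (f r) = (r < k)) /\ increasing f.

Lemma cnt_entries f k : column f k -> cnt (entries f) n = k.
Proof.
move=> [dom inc]; rewrite -size_list_of -(@pmap_list_of _ k) //; last by move=> r; rewrite dom.
rewrite size_pmap (eq_in_count (a2 := predT)) ?count_predT ?size_iota // => r.
by rewrite mem_iota dom.
Qed.

Lemma onth_pmap f k N : (forall r, isSome (f r) = (r < k)) -> k <= N ->
  forall r, onth (pmap f (iota 0 N)) r = f r.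
Proof.
move=> dom kN.
have -> : pmap f (iota 0 N) = pmap f (iota 0 k).
  rewrite -(subnKC kN) iotaD pmap_cat; set t := pmap f (iota _ (N - k)).
  suff -> : t = [::] by rewrite cats0.
  rewrite /t; apply: size0nil; rewrite size_pmap; apply/eqP; rewrite -leqn0 leqNgt -has_count.
  by apply/hasP => -[r]; rewrite mem_iota dom; lia.
have e : map some (pmap f (iota 0 k)) = map f (iota 0 k).
  rewrite pmapS_filter; congr map; apply/all_filterP/allP => r.
  by rewrite mem_iota dom.
move=> r; rewrite onthE [map _ _]e; have [rk|kr] := ltnP r k.
  by rewrite (nth_map 0) ?size_iota // nth_iota.
rewrite nth_default ?size_map ?size_iota //.
by have := dom r; rewrite ltnNge kr; case: (f r).
Qed.

Lemma column_onth s : sorted ltI s -> column (onth s) (size s).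
Proof.
move=> h; split=> [r|i i' x y ii' hx hy]; first exact: onthTE.
have hs : i' < size s by rewrite -onthTE hy.
have := sorted_ltn_nth ltI_trans x h; move=> /(_ i i').
rewrite !inE (onth_nth x x s i hx) (onth_nth x y s i' hy); apply=> //.
exact: ltn_trans hs.
Qed.

Lemma entries_onth s (u : 'I_n) : entries (onth s) u = (u \in s).
Proof. by apply/entries_ord/onthP. Qed.

Lemma cnt_none p a b : a <= b -> (forall v, a <= v < b -> ~~ p v) -> cnt p b = cnt p a.
Proof.
move=> /subnKC <-; elim: (b - a) => [|k IH] h; first by rewrite addn0.
by rewrite addnS cntS IH ?(negbTE (h _ _)) ?addn0 // => [|v hv]; try apply: h; lia.
Qed.

(** The row of an entry is the number of smaller entries, so a column is
    determined by its set of values. *)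
Lemma column_rank f k r (u : 'I_n) : column f k -> f r = Some u -> cnt (entries f) u = r.
Proof.
move=> [dom inc]; elim: r u => [|r IH] u hu.
  rewrite (@cnt_none _ 0) ?cnt0 // => v hv; apply/negP => /entriesP[[|r] [w [hw e]]].
    by move: hw; rewrite hu => -[e']; rewrite -e' in e; lia.
  by have := inc _ _ _ _ (ltn0Sn r) hu hw; lia.
case E: (f r) => [w|]; last by have := dom r; have := dom r.+1; rewrite hu E /=; lia.
have wu := inc _ _ _ _ (ltnSn r) E hu.
rewrite (@cnt_none _ w.+1) // => [|v hv].
  by rewrite cntS (IH _ E) (_ : entries f w = true) ?addn1 //; apply/entries_ord; exists r.
apply/negP => /entriesP[r' [z [hz e]]]; case: (ltngtP r r') => rr.
- have [e'|ne] := eqVneq r' r.+1.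
    by move: hz; rewrite e' hu => -[e'']; rewrite -e'' in e; lia.
  by have := inc r.+1 r' _ _ _ hu hz; lia.
- by have := inc _ _ _ _ rr hz E; lia.
- by move: hz; rewrite -rr E => -[e']; rewrite -e' in e; lia.
Qed.

Lemma column_iff f k r (u : 'I_n) : column f k ->
  f r = Some u <-> entries f u /\ cnt (entries f) u = r.
Proof.
move=> cf; split=> [h|[/entries_ord[r' h] <-]]; last by rewrite (column_rank cf h).
by split; [apply/entries_ord; exists r|exact: column_rank cf h].
Qed.

(** Together with [cnt_le_column]: the entrywise order of columns of the same
    length, in terms of counts. *)
Lemma column_le_cnt f g k : column f k -> column g k ->
  (forall r (x y : 'I_n), f r = Some x -> g r = Some y -> x <= y) ->
  forall y, cnt (entries g) y <= cnt (entries f) y.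
Proof.
move=> [df fi] [dg ig] h y.
pose R (v z : nat) := exists r (v' z' : 'I_n),
  [/\ g r = Some v', f r = Some z', v' = v :> nat & z' = z :> nat].
have := @cnt_inj (entries g) (entries f) R 0 y (leq0n y); rewrite !cnt0 !addn0; apply.
  move=> v /= vy /entriesP[r [v' [hv e]]].
  have : isSome (f r) by rewrite df -dg hv.
  case E: (f r) => [z|] // _; have zv := h _ _ _ E hv.
  by exists z; split; [lia|apply/entriesP; exists r, z|exists r, v', z].
move=> v w z [r [v' [z' [h1 h2 h3 h4]]]] [r' [w' [z'' [h5 h6 h7 h8]]]].
have e : z' = z'' by apply: val_inj; rewrite /= h4 h8.
rewrite -e in h6; have rr : r = r'.
  by rewrite -(column_rank (conj df fi) h2) (column_rank (conj df fi) h6).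
by move: h5; rewrite -rr h1 => -[e']; rewrite -h3 -h7 e'.
Qed.

Lemma cnt_le_column f g k : column f k -> column g k ->
  (forall y, cnt (entries g) y <= cnt (entries f) y) ->
  forall r (x y : 'I_n), f r = Some x -> g r = Some y -> x <= y.
Proof.
move=> cf cg h r x y hx hy; rewrite leqNgt; apply/negP => yx.
have [cy ry] := (column_iff r y cg).1 hy.
have := h y.+1; rewrite cntS cy ry.
by have := cnt_mono (entries f) yx; rewrite (column_rank cf hx); lia.
Qed.
End Columns.

(** * Column lengths, prefixes of a permutation and the staircase shape *)

Section ColumnLists.
Variable n : nat.
Implicit Types (F : filling n) (p : nat -> bool) (w : 'S_n).

Lemma cnt_ltn k y : cnt (fun i => i < k) y = minn k y.
Proof. by elim: y => [|y IH]; rewrite ?cnt0 ?cntS ?IH; lia. Qed.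

Definition heights M k := [seq colcnt M c n | c <- iota 0 k].

Lemma columnsE nu F : cols_ok F -> (forall c r, F (c, r) -> r < size nu) ->
  columns nu F =
  [seq s <- [seq list_of n (fun v => mat_of F v c) | c <- iota 0 (head 0 nu)] | s != [::]].
Proof.
move=> co bd; rewrite /columns; congr filter; apply: eq_map => c.
apply: pmap_list_of => [i i' x y ii' |r]; [exact: co|exact: bd].
Qed.

Lemma column_lengthsE nu F : cols_ok F -> (forall c r, F (c, r) -> r < size nu) ->
  column_lengths nu F = [seq l <- heights (mat_of F) (head 0 nu) | l != 0].
Proof.
move=> co bd; rewrite /column_lengths columnsE // /heights.
rewrite -(eq_map (fun c => size_list_of n (fun v => mat_of F v c))).
rewrite (map_comp size (fun c => list_of n (fun v => mat_of F v c))) [RHS]filter_map.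
congr map; apply: eq_filter => s.
by rewrite /= size_eq0.
Qed.

Lemma excess_heights m h (M : mat) : excess n m h M = \sum_(l <- heights M m) (l - h).
Proof.
rewrite /heights big_map /excess -(big_mkord predT (fun c => colcnt M c n - h)).
by rewrite /index_iota subn0.
Qed.

(** Empty columns contribute nothing to the excess, so it can be computed from
    the lengths of the nonempty columns, for any sufficiently large number m of
    columns. *)
Lemma excess_lengths m k h M : supp n k M -> k <= m ->
  excess n m h M = \sum_(l <- [seq l <- heights M k | l != 0]) (l - h).
Proof.
move=> s km; rewrite excess_heights /heights -(subnKC km) iotaD map_cat big_cat /=.
rewrite [X in _ + X]big1_seq ?addn0 => [|l /= /mapP[c]]; last first.
  by rewrite mem_iota => hc ->; rewrite (colcnt_out n s) //; lia.
by rewrite big_filter [RHS]big_mkcond; apply: eq_bigr => l _; case: eqP => // ->.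
Qed.

Lemma skewed_of_skew mu nu F : skew_tableau mu nu F ->
  is_partition mu /\ skewed (in_diagram mu) (in_diagram nu) F.
Proof.
move=> [[pm pn sub dom] ro co]; split=> //; split=> //; try exact: in_diagram_ideal.
by move=> [c r]; rewrite /in_diagram => h; exact: leq_trans h (sub _).
Qed.

Lemma skewed_bound mu nu F c r : skewed (in_diagram mu) (in_diagram nu) F ->
  F (c, r) -> r < size nu.
Proof.
move=> [_ _ _ dom _]; rewrite dom => /andP[+ _]; rewrite /in_diagram /= => h.
by rewrite ltnNge; apply/negP => sr; move: h; rewrite nth_default.
Qed.

Lemma in_diagram_head nu b : is_partition nu -> in_diagram nu b -> b.1 < head 0 nu.
Proof.
case: b => c r /in_diagram_ideal I h; rewrite -nth0.
exact: (I c c r 0 (leqnn _) (leq0n _) h).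
Qed.

(** The column of length k of the key of w, as a set of values. *)
Definition firsts w k : nat -> bool := fun v => v \in [seq val u | u <- take k (one_rowed w)].

Lemma firstsP w k v : reflect (exists2 i : 'I_n, i < k & w i = v :> nat) (firsts w k v).
Proof.
have mt (i : 'I_n) : (i \in take k (enum 'I_n)) = (i < k).
  rewrite -(mem_map val_inj) map_take val_enum_ord take_iota mem_iota /=.
  by have := ltn_ord i; lia.
rewrite /firsts /one_rowed -map_take -map_comp.
apply: (iffP mapP) => [[i hi ->]|[i hi <-]]; first by exists i; rewrite -?mt.
by exists i; rewrite ?mt.
Qed.

Lemma firsts_lt w k v : firsts w k v -> v < n.
Proof. by move=> /firstsP[i _ <-]. Qed.

Lemma sort_firsts w k :
  sort (fun x y : 'I_n => x <= y) (take k (one_rowed w)) = list_of n (firsts w k).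
Proof.
apply: sorted_list_of => [|u]; last by rewrite mem_sort /firsts (mem_map val_inj).
rewrite -(@sorted_map _ _ val ltn) ltn_sorted_uniq_leq (map_inj_uniq val_inj) sort_uniq.
rewrite take_uniq /=; last by rewrite map_inj_uniq ?enum_uniq //; exact: perm_inj.
by rewrite sorted_map; apply: sort_sorted => x y; exact: leq_total.
Qed.

Lemma cnt_firsts w k : k <= n -> cnt (firsts w k) n = k.
Proof.
move=> kn; rewrite -size_list_of -sort_firsts size_sort size_takel //.
by rewrite size_map size_enum_ord.
Qed.

Lemma entries_list_of p : (forall v, p v -> v < n) -> entries (onth (list_of n p)) = p.
Proof.
move=> h; apply/funext => v; have [vn|nv] := ltnP v n.
  by rewrite (entries_onth _ (Ordinal vn)) mem_list_of.
apply/idP/idP => [/entries_lt|/h]; lia.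
Qed.

Lemma column_list_of p k : cnt p n = k -> column (onth (list_of n p)) k.
Proof. by move=> <-; rewrite -size_list_of; apply: column_onth; exact: list_of_sorted. Qed.

(** A larger value at position a < k, a smaller one at position b with
    k <= b < j and the missing value v at position c >= j form a 312-pattern. *)
Lemma prefix_like_312 w j k : avoids_312 w -> k <= j ->
  prefix_like (firsts w k) (firsts w j).
Proof.
move=> av kj; split=> [v /firstsP[i ik <-]|v nv]; first by apply/firstsP; exists i => //; lia.
have [h|h] := pselect (forall u, firsts w k u -> u < v); [by left|right=> u uv pu].
apply: contrapT => nu.
have [vn|vn] := ltnP v n; last by case: h => z /firsts_lt; lia.
move/existsNP: h => [z /not_implyP[/firstsP[a ak wa] /negP zv]].
have /firstsP[b bj wb] := pu.
pose c := (w^-1)%g (Ordinal vn); have wc : w c = v :> nat by rewrite permKV.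
apply: av; exists a, b, c.
have kb : k <= b by rewrite leqNgt; apply/negP => bk; apply: nu; apply/firstsP; exists b.
have jc : j <= c.
  by rewrite leqNgt; apply/negP => cj; move/negP: nv; apply; apply/firstsP; exists c.
have nzv : z <> v by move=> e; apply: (negP nv); apply/firstsP; exists a; [lia|lia].
by split; lia.
Qed.

Lemma last_nonempty (A : eqType) (G : nat -> seq A) k :
  last [::] [seq s <- [seq G c | c <- iota 0 k] | s != [::]] != [::] ->
  exists q, [/\ q < k, last [::] [seq s <- [seq G c | c <- iota 0 k] | s != [::]] = G q
    & forall c, q < c < k -> G c = [::]].
Proof.
elim: k => [|k IH] //; rewrite -addn1 iotaD map_cat filter_cat /= add0n.
have [e|ne] := eqVneq (G k) [::]; rewrite ?cats0 => h.
  have [q [qk -> hq]] := IH h; exists q; split=> //; first by lia.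
  move=> c hc; have [->|nk] := eqVneq c k => //; apply: hq; lia.
by exists k; split; [lia|rewrite last_cat|move=> c; lia].
Qed.

End ColumnLists.

Section Staircase.
Variables n d : nat.
Local Notation la := (staircase_part n d).
Implicit Types (F T : filling n) (p : nat -> bool) (w : 'S_n).

Lemma nth_staircase r : nth 0 la r = minn d (n - r).
Proof.
have [rn|nr] := ltnP r n; first by rewrite nth_mkseq.
by rewrite nth_default ?size_mkseq //; lia.
Qed.

Lemma in_staircase c r : in_diagram la (c, r) = (c < d) && (r < n - c).
Proof. by rewrite /in_diagram nth_staircase /=; lia. Qed.

Lemma conj_staircase c : c < d -> conjugate_part la c = n - c.
Proof.
move=> cd; rewrite /conjugate_part /mkseq count_map.
have -> : count (preim (fun i => minn d (n - i)) (fun r => c < r)) (iota 0 n) =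
          count (fun i => i < n - c) (iota 0 n) by apply: eq_count => i /=; lia.
have := cnt_iota (fun i => i < n - c) 0 n; rewrite cnt0 !add0n size_filter cnt_ltn => <-.
by lia.
Qed.

Lemma skewed_ssyt T : ssyt la T -> skewed pred0 (in_diagram la) T.
Proof.
move=> /skewed_of_skew[_ sk]; apply: skewed_ext sk => b.
by rewrite /in_diagram nth_nil ltn0.
Qed.

Lemma column_ssyt T c : skewed pred0 (in_diagram la) T ->
  column (fun r => T (c, r)) (if c < d then n - c else 0).
Proof.
move=> [_ _ _ dom [_ co]]; split=> [r|i i' x y ii']; last exact: co.
by rewrite dom andbT in_staircase; case: (c < d).
Qed.

Lemma height_ssyt T c : skewed pred0 (in_diagram la) T ->
  colcnt (mat_of T) c n = if c < d then n - c else 0.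
Proof. by move=> /(column_ssyt c) /cnt_entries. Qed.

Lemma keyE w c r : c < d -> key la w (c, r) = onth (list_of n (firsts w (n - c))) r.
Proof. by move=> cd; rewrite /key /= conj_staircase // sort_firsts. Qed.

Hypothesis dn : d <= n.

Lemma head_staircase : head 0 la = d.
Proof. by rewrite -nth0 nth_staircase; lia. Qed.

(** [frank_last_column] provides some column of T of length n - c; the columns of
    the staircase shape have different lengths, so it is column c. *)
Lemma right_key_column T R c : ssyt la T -> is_right_key la T R -> c < d ->
  exists p, [/\ forall v, p v -> v < n, cnt p n = n - c,
    forall r, R (c, r) = onth (list_of n p) r & forall y, cnt p y <= colcnt (mat_of T) c y].
Proof.
move=> /skewed_ssyt skT [[_ _ _ domR] hR] cd.
have [|mu [nu [S [[skS rec fr] sz lst]]]] := hR c; first by rewrite head_staircase.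
have sT := skewed_straight skT; have [_ _ _ domT [roT coT]] := skT.
have [pm sk] := skewed_of_skew skS; have [[_ pn _ _] _ _] := skS.
have [rST _] := rectifies_raises rec pm sk.
have [_ _ _ _ [_ coS]] := sk.
have bT c' r : T (c', r) -> r < size la.
  by rewrite domT andbT in_staircase size_mkseq; lia.
set N := maxn (head 0 nu) d.
have supS : supp n (head 0 nu) (mat_of S).
  by apply: (mat_of_supp sk) => b; exact: in_diagram_head.
have supT : supp n d (mat_of T).
  by apply: (mat_of_supp skT) => -[c' r]; rewrite in_staircase => /andP[].
have supN : supp n N (mat_of S) by move=> v c' /supS[? ?]; split=> //; rewrite /N; lia.
have eS := column_lengthsE coS (fun c r => @skewed_bound _ _ _ _ c r sk).
have eT := column_lengthsE coT bT; rewrite head_staircase in eT.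
have frk h : excess n N h (mat_of S) = excess n N h (mat_of T).
  rewrite (excess_lengths h supS) ?leq_maxl // (excess_lengths h supT) ?leq_maxr //.
  by rewrite -eS -eT; exact: perm_big.
rewrite conj_staircase // in sz.
rewrite (columnsE coS (fun c r => @skewed_bound _ _ _ _ c r sk)) in sz lst.
have ne : last [::] [seq s <- [seq list_of n (fun v => mat_of S v c)
                             | c <- iota 0 (head 0 nu)] | s != [::]] != [::].
  by apply/eqP => e; move: sz; rewrite e /=; lia.
have [q [qk eq hq]] := last_nonempty ne; rewrite eq in sz lst.
rewrite size_list_of in sz.
have hlt c' : q < c' -> colcnt (mat_of S) c' n < colcnt (mat_of S) q n.
  move=> qc; rewrite [X in _ < X]sz; suff -> : colcnt (mat_of S) c' n = 0 by lia.
  have [hc|hc] := ltnP c' (head 0 nu); last exact: colcnt_out supS hc.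
  by rewrite /colcnt -size_list_of hq // qc.
have [q' h1 h2] := frank_last_column supN rST sT frk hlt.
have eqc : q' = c.
  by move: h1; rewrite (height_ssyt _ skT) /colcnt sz; case: ifP => _; lia.
subst q'; exists (fun v => mat_of S v q); split=> //.
- by move=> v /supS[].
- move=> r; rewrite -lst.
  have -> : columns la R = [seq pmap (fun i => R (j, i)) (iota 0 n) | j <- iota 0 d].
    rewrite /columns head_staircase size_mkseq; apply/all_filterP/allP => s /mapP[j].
    rewrite mem_iota => hj ->; rewrite -size_eq0 size_pmap -lt0n -has_count.
    apply/hasP; exists 0; first by rewrite mem_iota; lia.
    by rewrite domR in_staircase /in_diagram nth_nil; lia.
  rewrite (nth_map 0) ?size_iota // nth_iota // add0n (@onth_pmap _ _ (n - c)) //; last by lia.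
  by move=> r'; rewrite domR in_staircase /in_diagram nth_nil cd andbT.
Qed.

(** Because T <= R(T), by [right_key_column]. *)
Lemma right_key_le T R w : ssyt la T -> is_right_key la T R ->
  filling_le R (key la w) -> filling_le T (key la w).
Proof.
move=> sT rk le [c r] x y hx; have skT := skewed_ssyt sT.
have cd : c < d.
  have [_ _ _ dom _] := skT.
  by have := dom (c, r); rewrite hx in_staircase andbT => /esym/andP[].
have [p [pn pk eR pT]] := right_key_column sT rk cd.
rewrite keyE //; move: r hx => r hx hy.
have cT := column_ssyt c skT; rewrite cd in cT.
have cp := column_list_of pk.
have ck := column_list_of (cnt_firsts w (leq_subr c n)).
apply: (cnt_le_column cT ck _ hx hy) => z.
rewrite (entries_list_of (@firsts_lt _ w _)); apply: leq_trans (pT z).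
rewrite -(entries_list_of pn) -(entries_list_of (@firsts_lt _ w (n - c))).
apply: (column_le_cnt cp ck) => r' x' y' h1 h2.
by apply: (le (c, r')); rewrite ?eR ?keyE.
Qed.

End Staircase.

(** * Frank tableaux realizing the right key *)

Section Witness.
Variables n d : nat.
Local Notation la := (staircase_part n d).
Implicit Types (F T : filling n) (p : nat -> bool) (w : 'S_n).

Lemma straight_filling_eq D D' F F' : skewed pred0 D F -> skewed pred0 D' F' ->
  (forall c r, D (c, r) = (r < colcnt (mat_of F) c n)) ->
  (forall c r, D' (c, r) = (r < colcnt (mat_of F') c n)) ->
  mat_of F = mat_of F' -> F = F'.
Proof.
move=> [_ _ _ dom [_ co]] [_ _ _ dom' [_ co']] h h' e; apply/funext => -[c r].
have cF : column (fun r => F (c, r)) (colcnt (mat_of F) c n).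
  by split=> [i|i i' x y]; [rewrite dom h andbT|exact: co].
have cF' : column (fun r => F' (c, r)) (colcnt (mat_of F') c n).
  by split=> [i|i i' x y]; [rewrite dom' h' andbT|exact: co'].
have ce : entries (fun r => F (c, r)) = entries (fun r => F' (c, r)).
  by apply/funext => v; exact: (congr1 (fun M => M v c) e).
case E : (F (c, r)) => [u|].
  by symmetry; apply/(column_iff r u cF'); rewrite -ce; exact/(column_iff r u cF).
case E' : (F' (c, r)) => [u|] //; move/(column_iff r u cF'): E'; rewrite -ce.
by move=> /(column_iff r u cF); rewrite E.
Qed.

(** An order ideal meets each column in an initial segment of rows. *)
Lemma straight_dom D F N : bounded N D -> skewed pred0 D F ->
  forall c r, D (c, r) = (r < colcnt (mat_of F) c n).
Proof.
move=> bd [_ In _ dom [_ co]] c r.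
have [k hk] : exists k, forall i, D (c, i) = (i < k).
  exists (cnt (fun i => D (c, i)) N) => i; have [iN|Ni] := ltnP i N.
    apply: (@initial_cnt (fun i => D (c, i))) => // a ha a' h; exact: In h ha.
  have := cnt_le (fun i => D (c, i)) (leq0n N); rewrite cnt0 => h.
  by case E : (D (c, i)); [have [_ /=] := bd _ E|]; lia.
rewrite hk; congr (_ < _); symmetry; apply: (@cnt_entries _ (fun r => F (c, r))).
by split=> [i|i i' x y]; [rewrite dom hk andbT|exact: co].
Qed.

Lemma rows_adjacent Dm Dn F : ideal Dm -> ideal Dn ->
  (forall b, isSome (F b) = Dn b && ~~ Dm b) ->
  (forall c i (x y : 'I_n), F (c, i) = Some x -> F (c.+1, i) = Some y -> x <= y) -> rows_ok F.
Proof.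
move=> Im In dom adj c c' i x y ltcc; rewrite -(subnKC ltcc); elim: (c' - c.+1) y => [|k IH] y.
  by rewrite addn0; exact: adj.
rewrite addnS => hx hy; have := dom (c.+1 + k, i).
have := dom (c, i); have := dom ((c.+1 + k).+1, i).
rewrite hx hy => /esym/andP[ny _] /esym/andP[_ mx].
rewrite (In _ _ _ _ _ _ ny) // (_ : ~~ Dm (c.+1 + k, i)).
  case E: (F _) => [z|] // _; exact: leq_trans (IH _ hx E) (adj _ _ _ _ E hy).
by apply: contra mx; apply: Im; lia.
Qed.

Hypothesis dn : d <= n.

(** Realization of a matrix by a skew tableau. The matrix has the column lengths
    of the staircase, with that of column j moved to the right end. All columns
    but the last are shifted down by H = d - 1 - j rows: the columns d - 2 and
    d - 1 have lengths n - d + 1 and n - j when j < d - 1, so that they end in the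
    same row. When j = d - 1 there is no shift. *)
Section Place.
Variables (M : mat) (j : nat).
Hypotheses (jd : j < d) (sM : supp n d M).
Hypothesis ht : forall c, c < d ->
  colcnt M c n = if c < j then n - c else if c < d.-1 then n - c.+1 else n - j.
Hypothesis adjM : forall i y,
  colcnt M i.+1 y <= colcnt M i y + (colcnt M i.+1 n - colcnt M i n).

Let H := d.-1 - j.
Let off c := if c < d.-1 then H else 0.
Let bot c := off c + colcnt M c n.
Definition place_inner := nseq (d.-1 - j) d.-1.
Definition place_outer := mkseq (fun r => count (fun c => r < bot c) (iota 0 d)) (H + n).
Definition place : filling n := fun b =>
  if b.2 < off b.1 then None else onth (list_of n (fun v => M v b.1)) (b.2 - off b.1).

Let bot_anti c : bot c.+1 <= bot c.
Proof.
rewrite /bot /off; case: (ltnP c.+1 d) => h.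
  have := ht h; have := ht (ltnW h); rewrite /H.
  case: (ltnP c.+1 d.-1) => ?; case: (ltnP c d.-1) => ?;
  case: (ltnP c.+1 j) => ?; case: (ltnP c j) => ?; lia.
by rewrite (colcnt_out n sM h); case: ifP; lia.
Qed.

Let bot_anti' c c' : c <= c' -> bot c' <= bot c.
Proof.
move=> /subnKC <-; elim: (c' - c) => [|k IH]; rewrite ?addn0 // addnS.
exact: leq_trans (bot_anti _) IH.
Qed.

Let bot_pos c : (0 < bot c) = (c < d).
Proof.
case: (ltnP c d) => h; last first.
  by rewrite /bot /off (colcnt_out n sM h); case: ifP => //; lia.
have := ht h; rewrite /bot; case: (ltnP c j) => ?; case: (ltnP c d.-1) => ?; lia.
Qed.

Let in_outer c r : in_diagram place_outer (c, r) = (r < bot c).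
Proof.
have nthE : nth 0 place_outer r = count (fun c => r < bot c) (iota 0 d).
  rewrite /place_outer; have [rk|kr] := ltnP r (H + n); first by rewrite nth_mkseq.
  rewrite nth_default ?size_mkseq //; symmetry; apply/eqP; rewrite -leqn0 leqNgt -has_count.
  apply/hasP => -[c' _]; have := colcnt_bound c' n sM; rewrite /bot /off; case: ifP; lia.
rewrite /in_diagram nthE /=.
have := cnt_iota (fun c => r < bot c) 0 d; rewrite cnt0 !add0n size_filter => <-.
have [cd|dc] := ltnP c d.
  rewrite -(@initial_cnt (fun c => r < bot c)) // => a ha a' h.
  by apply: leq_trans ha (bot_anti' h).
have -> : bot c = 0 by apply/eqP; rewrite -leqn0 leqNgt bot_pos; lia.
by have := cnt_le (fun c => r < bot c) (leq0n d); rewrite cnt0; lia.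
Qed.

Let in_inner c r : in_diagram place_inner (c, r) = (r < off c).
Proof.
rewrite /in_diagram nth_nseq /off /H /=.
by case: (ltnP r (d.-1 - j)) => ?; case: (ltnP c d.-1) => ?; lia.
Qed.

Let colM c : column (onth (list_of n (fun v => M v c))) (colcnt M c n).
Proof. exact: column_list_of. Qed.
Let entriesM c : entries (onth (list_of n (fun v => M v c))) = fun v => M v c.
Proof. by apply: entries_list_of => v /sM[]. Qed.

Lemma mat_of_place : mat_of place = M.
Proof.
apply: matP => v c; apply/idP/idP => [/mat_ofP[r [u []]]|h].
  rewrite /place /=; case: ifP => // _ hu <-.
  by rewrite -[M u c](congr1 (fun p => p u) (entriesM c)); apply/entries_ord; exists (r - off c).
have [vn _] := sM h.
have /entries_ord[r hr] : entries (onth (list_of n (fun v => M v c))) (Ordinal vn).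
  by rewrite entriesM.
apply/mat_ofP; exists (off c + r), (Ordinal vn); split=> //; rewrite /place /=.
by rewrite addKn (_ : (off c + r < off c) = false) //; lia.
Qed.

(** Rows are weakly increasing by the inequality of [frank_pair]: its last term,
    the difference of the lengths, is H for the last two columns and 0 for any
    other two neighbours, which is also how much they are shifted against each
    other. *)
Lemma place_skew : skew_tableau place_inner place_outer place.
Proof.
have dom b : isSome (place b) = in_diagram place_outer b && ~~ in_diagram place_inner b.
  case: b => c r; rewrite in_outer in_inner /place /=.
  by case: ltnP => h; rewrite ?andbF // onthTE size_list_of /bot /colcnt; lia.
have pi : is_partition place_inner.
  apply: partition_nth => i; rewrite /place_inner !nth_nseq.
  by case: (ltnP i.+1 _) => ?; case: (ltnP i _) => ?; lia.
have po : is_partition place_outer.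
  apply: partition_nth => i; rewrite leqNgt; apply/negP => lt.
  have : in_diagram place_outer (nth 0 place_outer i, i.+1) by [].
  rewrite in_outer => /ltnW; rewrite -in_outer.
  by rewrite /in_diagram /= ltnn.
split.
- split=> // i; rewrite leqNgt; apply/negP => lt.
  have : in_diagram place_inner (nth 0 place_outer i, i) by [].
  rewrite in_inner => h; have : in_diagram place_outer (nth 0 place_outer i, i).
    by rewrite in_outer /bot; lia.
  by rewrite /in_diagram /= ltnn.
- apply: (rows_adjacent (in_diagram_ideal pi) (in_diagram_ideal po) dom) => c i x y.
  rewrite /place /=; case: ltnP => // h1 hx; case: ltnP => // h2 hy.
  have [] := (column_iff _ _ (colM c)).1 hx; rewrite entriesM => _ rx.
  have [] := (column_iff _ _ (colM c.+1)).1 hy; rewrite entriesM => My ry.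
  rewrite leqNgt; apply/negP => yx.
  have e : colcnt M c.+1 y.+1 = (i - off c.+1).+1 by rewrite colcntS My /colcnt ry addn1.
  have := adjM c y.+1; have := cnt_mono (fun v => M v c) yx.
  rewrite rx -/(colcnt _ _ _) e; move: h1 h2; rewrite /off /H.
  have cd : c.+1 < d by have [] := sM My.
  have := ht cd; have := ht (ltnW cd).
  case: (ltnP c.+1 d.-1) => ?; case: (ltnP c d.-1) => ?;
  case: (ltnP c.+1 j) => ?; case: (ltnP c j) => ?; lia.
move=> c i i' x y ii'; rewrite /place /=; case: ltnP => // h1 hx; case: ltnP => // h2 hy.
by apply: ((colM c).2 _ _ _ _ _ hx hy); lia.
Qed.

Lemma head_place : head 0 place_outer = d.
Proof.
have := in_outer (head 0 place_outer) 0; have := in_outer d 0; rewrite !bot_pos.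
have := in_outer d.-1 0; rewrite bot_pos; rewrite /in_diagram /= nth0; lia.
Qed.

Lemma place_columns : columns place_outer place =
  [seq s <- [seq list_of n (fun v => M v c) | c <- iota 0 d] | s != [::]].
Proof.
have [_ sk] := skewed_of_skew place_skew; have [_ _ _ _ [_ co]] := sk.
rewrite columnsE ?mat_of_place ?head_place // => c r; exact: skewed_bound sk.
Qed.

Lemma place_lengths : column_lengths place_outer place = [seq l <- heights n M d | l != 0].
Proof.
have [_ sk] := skewed_of_skew place_skew; have [_ _ _ _ [_ co]] := sk.
rewrite column_lengthsE ?mat_of_place ?head_place // => c r; exact: skewed_bound sk.
Qed.

End Place.

(** Apart from the bound by the key, supplied by [lower_chain], the matrix has the
    column lengths of T, so that [frank_pair] makes it realizable. Any
    rectification of the realization is straight and reached by raisings, hence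
    has the matrix of T. *)
Lemma frank_witness w T j : ssyt la T -> filling_le T (key la w) -> avoids_312 w -> j < d ->
  exists p, [/\ forall v, p v -> v < n, cnt p n = n - j,
    forall y, cnt (firsts w (n - j)) y <= cnt p y &
    exists mu nu S, [/\ frank_rectifies_to mu nu S la T,
      size (last [::] (columns nu S)) = n - j & last [::] (columns nu S) = list_of n p]].
Proof.
move=> sT le av jd; have skT := skewed_ssyt sT.
have [_ _ _ domT [roT coT]] := skT.
have stT := skewed_straight skT.
have supT : supp n d (mat_of T).
  by apply: (mat_of_supp skT) => -[c' r]; rewrite in_staircase => /andP[].
have hT c := height_ssyt c skT.
have lePT c : c < d -> forall y, cnt (firsts w (n - c)) y <= colcnt (mat_of T) c y.
  move=> cd y; have cT := column_ssyt c skT; rewrite cd in cT.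
  rewrite -(entries_list_of (@firsts_lt _ w (n - c))).
  apply: (column_le_cnt cT (column_list_of (cnt_firsts w (leq_subr c n)))) => r x z h1 h2.
  by apply: (le (c, r)); rewrite ?keyE.
have cj : cnt (firsts w (n - j)) n = colcnt (mat_of T) j n.
  by rewrite hT jd cnt_firsts // leq_subr.
have hQ k : j < k -> k < d -> [/\ prefix_like (firsts w (n - k)) (firsts w (n - j)),
    cnt (firsts w (n - k)) n = colcnt (mat_of T) k n &
    forall y, cnt (firsts w (n - k)) y <= colcnt (mat_of T) k y].
  move=> jk kd; split; last exact: lePT.
    by apply: prefix_like_312 => //; lia.
  by rewrite hT kd cnt_firsts // leq_subr.
have jd' : j <= d.-1 by lia.
have dd : d.-1 < d by lia.
have [M [[rM sM] hM _ pM _]] :=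
  lower_chain supT stT jd (@firsts_lt _ w _) cj (lePT j jd) hQ jd' dd.
have ht c : c < d -> colcnt M c n =
    if c < j then n - c else if c < d.-1 then n - c.+1 else n - j.
  move=> cd; rewrite hM hT; case: (ltnP c j) => ?; first by rewrite (_ : c < d); [|lia].
  case: (ltnP c d.-1) => ?; first by rewrite (_ : c.+1 < d); [|lia].
  by rewrite (_ : c == d.-1) ?jd; [|lia].
have perm : perm_eq (heights n M d) (heights n (mat_of T) d).
  rewrite /heights (eq_map hM).
  rewrite (map_comp (fun c => colcnt (mat_of T) c n)
    (fun c => if c < j then c else if c < d.-1 then c.+1 else if c == d.-1 then j else c)).
  set s := map _ (iota 0 d); have us : uniq s.
    rewrite map_inj_in_uniq ?iota_uniq // => a b; rewrite !mem_iota => ha hb.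
    case: (ltnP a j) => ?; case: (ltnP b j) => ?; case: (ltnP a d.-1) => ?;
    case: (ltnP b d.-1) => ?; case: (eqVneq a d.-1) => ?; case: (eqVneq b d.-1) => ?; lia.
  have sub : {subset s <= iota 0 d}.
    move=> u /mapP[c]; rewrite !mem_iota => hc ->.
    by case: (ltnP c j) => ?; case: (ltnP c d.-1) => ?; case: (eqVneq c d.-1) => ?; lia.
  have [|_ e] := uniq_min_size us sub; first by rewrite size_map.
  by apply: perm_map; apply: uniq_perm => //; exact: iota_uniq.
have eqexcess h : excess n d h M = excess n d h (mat_of T).
  by rewrite !excess_heights; exact: perm_big.
have adjM i y := @frank_pair n d _ _ i y sM rM stT eqexcess.
have hd : colcnt M d.-1 n = n - j by rewrite ht ?ltnn; [case: ltnP|]; lia.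
have skS := place_skew jd sM ht adjM; have matS := mat_of_place jd sM.
have [pm sk] := skewed_of_skew skS; have [[_ pn _ _] _ _] := skS.
have eC := place_columns jd sM ht adjM; have eL := place_lengths jd sM ht adjM.
set nu := place_outer M j in skS sk pn eC eL; set S := place M j in skS sk matS eC eL.
have elast : last [::] (columns nu S) = list_of n (fun v => M v d.-1).
  rewrite eC (_ : iota 0 d = rcons (iota 0 d.-1) d.-1); last first.
    by rewrite -cats1 -{1}(prednK (leq_ltn_trans (leq0n j) jd)) -addn1 iotaD.
  rewrite map_rcons filter_rcons ifT ?last_rcons //.
  by rewrite -size_eq0 size_list_of -/(colcnt _ _ _) hd; lia.
have bd : bounded (maxn (head 0 nu) (size nu)) (in_diagram nu).
  move=> [c r] h; have /= hc := in_diagram_head pn h; split=> /=; first by lia.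
  suff : r < size nu by lia.
  by rewrite ltnNge; apply/negP => sr; move: h; rewrite /in_diagram /= nth_default.
have [T' rec] := rectifies_ex bd pm sk.
have [rS [D skT' sub]] := rectifies_raises rec pm sk.
rewrite matS in rS.
have bdT : bounded (n + d) (in_diagram la).
  by move=> [c r]; rewrite in_staircase /=; lia.
have bdT' : bounded (maxn (head 0 nu) (size nu)) D by move=> b /sub /bd.
have eT : T' = T.
  apply: (straight_filling_eq skT' skT).
  - exact: straight_dom bdT' skT'.
  - exact: straight_dom bdT skT.
  - exact: straight_unique sM rS rM (skewed_straight skT') stT.
exists (fun v => M v d.-1); split=> //.
  by move=> v /sM[].
exists (place_inner j), nu, S; split=> //; last by rewrite elast size_list_of.
split=> //; first by rewrite -eT.
rewrite eL (column_lengthsE coT) ?(head_staircase dn); first exact: perm_filter.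
by move=> c r; rewrite domT andbT in_staircase size_mkseq; lia.
Qed.

End Witness.

Local Open Scope classical_set_scope.

Theorem proposition3p7p1 (n d : nat) (w : 'S_n) :
  1 <= n -> 1 <= d <= n -> avoids_312 w ->
  demazure (staircase_part n d) w =
  [set T : filling n |
     ssyt (staircase_part n d) T /\ filling_le T (key (staircase_part n d) w)].
Proof.
move=> _ /andP[_ dn] av; apply/seteqP; split=> T /= [sT].
  by move=> [R [rk le]]; split=> //; exact: right_key_le rk le.
move=> le; split=> //.
have /choice[p hp] : forall j, exists p : nat -> bool, j < d ->
    [/\ forall v, p v -> v < n, cnt p n = n - j,
    forall y, cnt (firsts w (n - j)) y <= cnt p y &
    exists mu nu S, [/\ frank_rectifies_to mu nu S (staircase_part n d) T,
      size (last [::] (columns nu S)) = n - j & last [::] (columns nu S) = list_of n p]].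
  move=> j; have [jd|dj] := ltnP j d; last by exists pred0.
  by have [p hp] := frank_witness dn sT le av jd; exists p.
pose R : filling n := fun b => if b.1 < d then onth (list_of n (p b.1)) b.2 else None.
have domR b : isSome (R b) = in_diagram (staircase_part n d) b && ~~ in_diagram [::] b.
  case: b => c r; rewrite in_staircase /in_diagram nth_nil /R /= andbT.
  by case: ltnP => cd //; have [_ pc _ _] := hp c cd; rewrite onthTE size_list_of pc.
have colR c : c < d -> column (fun r => R (c, r)) (n - c).
  move=> cd; have [_ pc _ _] := hp c cd; rewrite /R /= cd; exact: column_list_of.
exists R; split; last first.
  move=> [c r] x y hx; have cd : c < d by move: hx; rewrite /R /=; case: ltnP.
  have [pn pc pk _] := hp c cd; rewrite keyE // => hy.
  have cK := column_list_of (cnt_firsts w (leq_subr c n)).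
  apply: (cnt_le_column (colR c cd) cK _ hx hy) => z.
  by rewrite /R /= cd !entries_list_of //; exact: firsts_lt.
have entriesR c : c < d -> (fun v => mat_of R v c) = p c.
  move=> cd; have [pn _ _ _] := hp c cd; rewrite -(entries_list_of pn).
  by apply/funext => v; rewrite /mat_of /R /= cd.
split.
  split=> //; last by move=> i; rewrite nth_nil.
  by apply: partition_nth => i; rewrite !nth_staircase; lia.
move=> j; rewrite (head_staircase dn) => jd.
have [pn pc _ [mu [nu [S [h1 h2 h3]]]]] := hp j jd.
exists mu, nu, S; split=> //; first by rewrite conj_staircase.
rewrite h3 columnsE => [|c i i' x y ii' hx hy|c r]; last first.
- by rewrite domR in_staircase /in_diagram nth_nil size_mkseq; lia.
- have cd : c < d by move: hx; rewrite /R /=; case: ltnP.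
  exact: (colR c cd).2 ii' hx hy.
rewrite (head_staircase dn) (all_filterP _) => [|].
  by rewrite (nth_map 0) ?size_iota // nth_iota // add0n entriesR.
apply/allP => s /mapP[c]; rewrite mem_iota => hc ->; have cd : c < d by lia.
by have [_ pc' _ _] := hp c cd; rewrite entriesR // -size_eq0 size_list_of pc'; lia.
Qed.
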